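(* Let $D$ be a generalized Dynkin diagram with a node $\alpha$ such that no multiple arrow points towards $\alpha$ (i.e. no arrow of $D$ directed towards $\alpha$ has multiplicity greater than $1$). Then for the grading associated with $\alpha$ on the Lie algebra $\mathfrak{g}=\mathfrak{g}(D)$ we have the inequality $$\dim\mathfrak{g}_2\leq\binom{\dim\mathfrak{g}_1}{2}-(2\dim\mathfrak{g}_1-3).$$
   Context: **Kac-Moody Lie algebras.** A generalized Cartan matrix is a matrix $A=(a_{i,j})_{1\le i,j\le n}$ with $a_{i,i}=2$, $a_{i,j}\in\mathbb{Z}_{\le 0}$ for $i\ne j$, and $a_{i,j}=0\Rightarrow a_{j,i}=0$. Its generalized Dynkin diagram $D$ has nodes $\alpha_1,\dots,\alpha_n$ and, for $i\neq j$, an arrow from $\alpha_i$ to $\alpha_j$ of multiplicity $-a_{j,i}$ (no arrow is drawn if $a_{j,i}=0$). A realization of $A$ is a complex vector space $\mathfrak{h}$ of dimension $n+\mathrm{corank}(A)$ with linearly independent subsets $\{\alpha_1^\vee,\dots,\alpha_n^\vee\}\subset\mathfrak{h}$ and $\{\alpha_1,\dots,\alpha_n\}\subset\mathfrak{h}^*$ (the simple roots) such that $\alpha_j(\alpha_i^\vee)=a_{i,j}$; it is unique up to isomorphism. Let $\widetilde{\mathfrak{g}}(A)$ be the complex Lie algebra generated by $\mathfrak{h}$ and $e_i,f_i$ ($1\le i\le n$) with relations $[\mathfrak{h},\mathfrak{h}]=0$, $[e_i,f_j]=\delta_{i,j}\alpha_i^\vee$, $[h,e_i]=\alpha_i(h)e_i$,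 $[h,f_i]=-\alpha_i(h)f_i$ for $h\in\mathfrak{h}$. The Kac-Moody Lie algebra is $\mathfrak{g}(D)=\mathfrak{g}(A)=\widetilde{\mathfrak{g}}(A)/\mathfrak{r}$, where $\mathfrak{r}$ is the unique maximal ideal with $\mathfrak{r}\cap\mathfrak{h}=\{0\}$. **Grading.** For $\delta\in\mathfrak{h}^*$ let $\mathfrak{g}_\delta=\{x\in\mathfrak{g}: [h,x]=\delta(h)x\ \forall h\in\mathfrak{h}\}$, with $\mathfrak{g}=\mathfrak{g}(D)$. Then $\mathfrak{g}=\bigoplus_{\delta}\mathfrak{g}_\delta$ over $\delta$ in the root lattice $\bigoplus_j\mathbb{Z}\alpha_j$, and the summand for $\delta=0$ is $\mathfrak h$. Given a node (simple root) $\alpha$, the associated $\mathbb{Z}$-grading $\mathfrak{g}=\bigoplus_{i\in\mathbb{Z}}\mathfrak{g}_i$ has $\mathfrak{g}_i$ equal to the sum of all $\mathfrak{g}_\delta$ such that the coefficient of $\alpha$ in $\delta$ is $i$. *)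

(* Defs.v *)
From HB Require Import structures.
From mathcomp Require Import all_boot all_order all_algebra.
From mathcomp Require Import boolp classical_sets reals.
From mathcomp Require Export complex.

Set Implicit Arguments.
Unset Strict Implicit.
Unset Printing Implicit Defensive.

Import Order.TTheory GRing.Theory Num.Theory.
Local Open Scope ring_scope.
Local Open Scope quotient_scope.
Local Open Scope classical_set_scope.

HB.mixin Record Lmodule_isLie (K : fieldType) L of GRing.Lmodule K L := {
  bracket : L -> L -> L;
  bracketPl : forall (a : K) (x y z : L),
    bracket (a *: x + y) z = a *: bracket x z + bracket y z;
  bracketPr : forall (a : K) (x y z : L),
    bracket z (a *: x + y) = a *: bracket z x + bracket z y;
  bracketxx : forall x : L, bracket x x = 0;
  jacobi : forall x y z : L,
    bracket x (bracket y z) + bracket y (bracket z x)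
      + bracket z (bracket x y) = 0
}.

#[short(type="lieAlgType")]
HB.structure Definition LieAlgebra (K : fieldType) :=
  {L of GRing.Lmodule K L & Lmodule_isLie K L}.

Section Presentation.
Variables (K : fieldType) (X : Type).

Inductive lie_term : Type :=
  | LGen of X
  | LZero
  | LAdd of lie_term & lie_term
  | LScale of K & lie_term
  | LBr of lie_term & lie_term.

HB.instance Definition _ := gen_eqMixin lie_term.
HB.instance Definition _ := gen_choiceMixin lie_term.

Variable rel : lie_term -> lie_term -> Prop.

(* The smallest congruence that contains [rel] and makes the quotient a Lie
   algebra; the opposite of [x] is [LScale (-1) x]. *)
Inductive lie_cong : lie_term -> lie_term -> Prop :=
  | cong_rel x y : rel x y -> lie_cong x y
  | cong_refl x : lie_cong x x
  | cong_sym x y : lie_cong x y -> lie_cong y x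
  | cong_trans x y z : lie_cong x y -> lie_cong y z -> lie_cong x z
  | cong_add x x' y y' : lie_cong x x' -> lie_cong y y' ->
      lie_cong (LAdd x y) (LAdd x' y')
  | cong_scale a x x' : lie_cong x x' -> lie_cong (LScale a x) (LScale a x')
  | cong_br x x' y y' : lie_cong x x' -> lie_cong y y' ->
      lie_cong (LBr x y) (LBr x' y')
  | cong_addA x y z : lie_cong (LAdd x (LAdd y z)) (LAdd (LAdd x y) z)
  | cong_addC x y : lie_cong (LAdd x y) (LAdd y x)
  | cong_add0 x : lie_cong (LAdd LZero x) x
  | cong_addN x : lie_cong (LAdd (LScale (-1) x) x) LZero
  | cong_scaleA a b x : lie_cong (LScale a (LScale b x)) (LScale (a * b) x)
  | cong_scale1 x : lie_cong (LScale 1 x) x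
  | cong_scaleDr a x y :
      lie_cong (LScale a (LAdd x y)) (LAdd (LScale a x) (LScale a y))
  | cong_scaleDl a b x :
      lie_cong (LScale (a + b) x) (LAdd (LScale a x) (LScale b x))
  | cong_brPl a x y z : lie_cong (LBr (LAdd (LScale a x) y) z)
                                 (LAdd (LScale a (LBr x z)) (LBr y z))
  | cong_brPr a x y z : lie_cong (LBr z (LAdd (LScale a x) y))
                                 (LAdd (LScale a (LBr z x)) (LBr z y))
  | cong_brxx x : lie_cong (LBr x x) LZero
  | cong_jacobi x y z :
      lie_cong (LAdd (LAdd (LBr x (LBr y z)) (LBr y (LBr z x)))
                     (LBr z (LBr x y))) LZero.

Definition lie_congb (x y : lie_term) : bool := `[< lie_cong x y >].

Lemma lie_congb_equiv : equiv_class_of lie_congb.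
Proof.
split=> [x|x y|y x z].
- by apply/asboolP; exact: cong_refl.
- by apply/asboolP/asboolP; exact: cong_sym.
- by move=> /asboolP xy /asboolP yz; apply/asboolP; exact: cong_trans xy yz.
Qed.

Canonical lie_cong_equiv := EquivRelPack lie_congb_equiv.

Definition presented_lie : Type := {eq_quot lie_congb}.
HB.instance Definition _ := Choice.on presented_lie.
HB.instance Definition _ : EqQuotient _ lie_congb presented_lie :=
  EqQuotient.on presented_lie.

Local Notation pi := (\pi_presented_lie).

Lemma presented_eqP x y : (pi x = pi y) <-> lie_cong x y.
Proof. by split=> [/eqmodP /asboolP|?] //; apply/eqmodP/asboolP. Qed.

Lemma pi_surj u : exists x, u = pi x.
Proof. by exists (repr u); rewrite reprK. Qed.

Lemma presented_reprK x : lie_cong (repr (pi x)) x.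
Proof. by apply/presented_eqP; rewrite reprK. Qed.

Definition padd (u v : presented_lie) : presented_lie :=
  pi (LAdd (repr u) (repr v)).
Definition popp (u : presented_lie) : presented_lie :=
  pi (LScale (-1) (repr u)).
Definition pscale (a : K) (u : presented_lie) : presented_lie :=
  pi (LScale a (repr u)).
Definition pbr (u v : presented_lie) : presented_lie :=
  pi (LBr (repr u) (repr v)).

Lemma paddE x y : padd (pi x) (pi y) = pi (LAdd x y).
Proof. by apply/presented_eqP; apply: cong_add; exact: presented_reprK. Qed.
Lemma poppE x : popp (pi x) = pi (LScale (-1) x).
Proof. by apply/presented_eqP; apply: cong_scale; exact: presented_reprK. Qed.
Lemma pscaleE a x : pscale a (pi x) = pi (LScale a x).
Proof. by apply/presented_eqP; apply: cong_scale; exact: presented_reprK. Qed.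
Lemma pbrE x y : pbr (pi x) (pi y) = pi (LBr x y).
Proof. by apply/presented_eqP; apply: cong_br; exact: presented_reprK. Qed.

Lemma paddA : associative padd.
Proof.
move=> u v w; case: (pi_surj u) => {}u ->; case: (pi_surj v) => {}v ->;
  case: (pi_surj w) => {}w ->; rewrite !paddE.
by apply/presented_eqP; exact: cong_addA.
Qed.
Lemma paddC : commutative padd.
Proof.
move=> u v; case: (pi_surj u) => {}u ->; case: (pi_surj v) => {}v ->;
  rewrite !paddE.
by apply/presented_eqP; exact: cong_addC.
Qed.
Lemma padd0 : left_id (pi LZero) padd.
Proof.
by move=> u; case: (pi_surj u) => {}u ->; rewrite paddE; apply/presented_eqP;
  exact: cong_add0.
Qed.
Lemma paddN : left_inverse (pi LZero) popp padd.
Proof.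
move=> u; case: (pi_surj u) => {}u ->; rewrite poppE paddE.
by apply/presented_eqP; exact: cong_addN.
Qed.
HB.instance Definition _ :=
  GRing.isZmodule.Build presented_lie paddA paddC padd0 paddN.

Lemma pscaleA a b u : pscale a (pscale b u) = pscale (a * b) u.
Proof.
by case: (pi_surj u) => {}u ->; rewrite !pscaleE; apply/presented_eqP;
  exact: cong_scaleA.
Qed.
Lemma pscale1 : left_id 1 pscale.
Proof.
by move=> u; case: (pi_surj u) => {}u ->; rewrite !pscaleE; apply/presented_eqP;
  exact: cong_scale1.
Qed.
Lemma pscaleDr : right_distributive pscale +%R.
Proof.
move=> a u v; case: (pi_surj u) => {}u ->; case: (pi_surj v) => {}v ->;
  rewrite [_ + _]paddE !pscaleE [RHS]paddE.
by apply/presented_eqP; exact: cong_scaleDr.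
Qed.
Lemma pscaleDl u : {morph pscale^~ u : a b / a + b}.
Proof.
move=> a b; case: (pi_surj u) => {}u ->; rewrite /= !pscaleE [RHS]paddE.
by apply/presented_eqP; exact: cong_scaleDl.
Qed.
HB.instance Definition _ := GRing.Zmodule_isLmodule.Build K presented_lie
  pscaleA pscale1 pscaleDr pscaleDl.

Lemma pi_add x y : pi (LAdd x y) = pi x + pi y.
Proof. by rewrite [RHS]paddE. Qed.
Lemma pi_scale a x : pi (LScale a x) = a *: pi x.
Proof. by rewrite [RHS]pscaleE. Qed.

Lemma pbrPl (a : K) (x y z : presented_lie) :
  pbr (a *: x + y) z = a *: pbr x z + pbr y z.
Proof.
case: (pi_surj x) => {}x ->; case: (pi_surj y) => {}y ->;
  case: (pi_surj z) => {}z ->; rewrite -pi_scale -pi_add !pbrE.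
by rewrite -pi_scale -pi_add; apply/presented_eqP; exact: cong_brPl.
Qed.
Lemma pbrPr (a : K) (x y z : presented_lie) :
  pbr z (a *: x + y) = a *: pbr z x + pbr z y.
Proof.
case: (pi_surj x) => {}x ->; case: (pi_surj y) => {}y ->;
  case: (pi_surj z) => {}z ->; rewrite -pi_scale -pi_add !pbrE.
by rewrite -pi_scale -pi_add; apply/presented_eqP; exact: cong_brPr.
Qed.
Lemma pbrxx (x : presented_lie) : pbr x x = 0.
Proof.
by case: (pi_surj x) => {}x ->; rewrite pbrE; apply/presented_eqP;
  exact: cong_brxx.
Qed.
Lemma pjacobi (x y z : presented_lie) :
  pbr x (pbr y z) + pbr y (pbr z x) + pbr z (pbr x y) = 0.
Proof.
case: (pi_surj x) => {}x ->; case: (pi_surj y) => {}y ->;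
  case: (pi_surj z) => {}z ->; rewrite !pbrE -!pi_add.
by apply/presented_eqP; exact: cong_jacobi.
Qed.
HB.instance Definition _ := Lmodule_isLie.Build K presented_lie
  pbrPl pbrPr pbrxx pjacobi.

Definition lie_gen (x : X) : presented_lie := pi (LGen x).

End Presentation.

Section Quotient.
Variables (K : fieldType) (L : lieAlgType K).

Record lie_ideal := LieIdeal {
  ideal_set :> set L;
  ideal0 : ideal_set 0;
  idealP : forall (a : K) (x y : L),
    ideal_set x -> ideal_set y -> ideal_set (a *: x + y);
  ideal_br : forall x y : L, ideal_set y -> ideal_set (bracket x y)
}.

Definition maximal_ideal_avoiding (H : set L) (r : lie_ideal) : Prop :=
  r `&` H = [set 0] /\
  forall s : lie_ideal, s `&` H = [set 0] -> r `<=` s -> s `<=` r.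

Variable I : lie_ideal.

Lemma idealD x y : ideal_set I x -> ideal_set I y -> ideal_set I (x + y).
Proof. by move=> Ix Iy; rewrite -[x]scale1r; exact: idealP. Qed.
Lemma idealZ a x : ideal_set I x -> ideal_set I (a *: x).
Proof. by move=> Ix; rewrite -[_ *: _]addr0; apply: idealP => //; exact: ideal0. Qed.
Lemma idealN x : ideal_set I x -> ideal_set I (- x).
Proof. by rewrite -scaleN1r; exact: idealZ. Qed.
Lemma bracketC (x y : L) : bracket x y = - bracket y x.
Proof.
have brD (u v w : L) : bracket (u + v) w = bracket u w + bracket v w.
  by rewrite -[u]scale1r bracketPl !scale1r.
have brDr (u v w : L) : bracket w (u + v) = bracket w u + bracket w v.
  by rewrite -[u]scale1r bracketPr !scale1r.
apply/eqP; rewrite -addr_eq0; apply/eqP.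
by have := bracketxx (x + y); rewrite brD !brDr !bracketxx add0r addr0.
Qed.

Definition ideal_eqb (x y : L) : bool := `[< ideal_set I (x - y) >].

Lemma ideal_eqb_equiv : equiv_class_of ideal_eqb.
Proof.
have sym x y : ideal_eqb x y -> ideal_eqb y x.
  by move=> /asboolP /idealN; rewrite opprB => ?; apply/asboolP.
split=> [x|x y|y x z].
- by apply/asboolP; rewrite subrr; exact: ideal0.
- by apply/idP/idP; exact: sym.
- move=> /asboolP xy /asboolP yz; apply/asboolP.
  by have := idealD xy yz; rewrite addrA subrK.
Qed.

Canonical ideal_eq_equiv := EquivRelPack ideal_eqb_equiv.

Definition lie_quot : Type := {eq_quot ideal_eqb}.
HB.instance Definition _ := Choice.on lie_quot.
HB.instance Definition _ : EqQuotient _ ideal_eqb lie_quot :=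
  EqQuotient.on lie_quot.

Local Notation pi := (\pi_lie_quot).

Lemma lie_quot_eqP x y : (pi x = pi y) <-> ideal_set I (x - y).
Proof. by split=> [/eqmodP /asboolP|?] //; apply/eqmodP/asboolP. Qed.

Lemma lie_quot_surj u : exists x, u = pi x.
Proof. by exists (repr u); rewrite reprK. Qed.

Lemma lie_quot_reprK x : ideal_set I (repr (pi x) - x).
Proof. by apply/lie_quot_eqP; rewrite reprK. Qed.

Definition qadd (u v : lie_quot) : lie_quot := pi (repr u + repr v).
Definition qopp (u : lie_quot) : lie_quot := pi (- repr u).
Definition qscale (a : K) (u : lie_quot) : lie_quot := pi (a *: repr u).
Definition qbr (u v : lie_quot) : lie_quot := pi (bracket (repr u) (repr v)).

Lemma qaddE x y : qadd (pi x) (pi y) = pi (x + y).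
Proof.
apply/lie_quot_eqP; rewrite opprD addrACA.
by apply: idealD; exact: lie_quot_reprK.
Qed.
Lemma qoppE x : qopp (pi x) = pi (- x).
Proof.
by apply/lie_quot_eqP; rewrite -opprD; apply: idealN; exact: lie_quot_reprK.
Qed.
Lemma qscaleE a x : qscale a (pi x) = pi (a *: x).
Proof.
by apply/lie_quot_eqP; rewrite -scalerBr; apply: idealZ; exact: lie_quot_reprK.
Qed.
Lemma qbrE x y : qbr (pi x) (pi y) = pi (bracket x y).
Proof.
apply/lie_quot_eqP; set x' := repr (pi x); set y' := repr (pi y).
have -> : bracket x' y' - bracket x y
       = bracket x' (y' - y) - bracket y (x' - x).
  have brB (z u v : L) : bracket z (u - v) = bracket z u - bracket z v.
    by rewrite addrC -scaleN1r bracketPr scaleN1r addrC.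
  rewrite !brB (bracketC y x') (bracketC y x) opprK [- bracket x' y + _]addrC.
  by rewrite opprD opprK addrACA addNr addr0.
by apply: idealD; [|apply: idealN]; apply: ideal_br; exact: lie_quot_reprK.
Qed.

Lemma qaddA : associative qadd.
Proof.
by move=> u v w; case: (lie_quot_surj u) => {}u ->;
  case: (lie_quot_surj v) => {}v ->; case: (lie_quot_surj w) => {}w ->;
  rewrite !qaddE addrA.
Qed.
Lemma qaddC : commutative qadd.
Proof.
by move=> u v; case: (lie_quot_surj u) => {}u ->;
  case: (lie_quot_surj v) => {}v ->; rewrite !qaddE addrC.
Qed.
Lemma qadd0 : left_id (pi 0) qadd.
Proof. by move=> u; case: (lie_quot_surj u) => {}u ->; rewrite qaddE add0r. Qed.
Lemma qaddN : left_inverse (pi 0) qopp qadd.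
Proof.
by move=> u; case: (lie_quot_surj u) => {}u ->; rewrite qoppE qaddE addNr.
Qed.
HB.instance Definition _ :=
  GRing.isZmodule.Build lie_quot qaddA qaddC qadd0 qaddN.

Lemma qscaleA a b u : qscale a (qscale b u) = qscale (a * b) u.
Proof. by case: (lie_quot_surj u) => {}u ->; rewrite !qscaleE scalerA. Qed.
Lemma qscale1 : left_id 1 qscale.
Proof.
by move=> u; case: (lie_quot_surj u) => {}u ->; rewrite !qscaleE scale1r.
Qed.
Lemma qscaleDr : right_distributive qscale +%R.
Proof.
move=> a u v; case: (lie_quot_surj u) => {}u ->;
  case: (lie_quot_surj v) => {}v ->; rewrite [_ + _]qaddE !qscaleE [RHS]qaddE.
by rewrite scalerDr.
Qed.
Lemma qscaleDl u : {morph qscale^~ u : a b / a + b}.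
Proof.
by move=> a b; case: (lie_quot_surj u) => {}u ->;
  rewrite /= !qscaleE [RHS]qaddE scalerDl.
Qed.
HB.instance Definition _ := GRing.Zmodule_isLmodule.Build K lie_quot
  qscaleA qscale1 qscaleDr qscaleDl.

Lemma lie_quot_add x y : pi (x + y) = pi x + pi y.
Proof. by rewrite [RHS]qaddE. Qed.
Lemma lie_quot_scale a x : pi (a *: x) = a *: pi x.
Proof. by rewrite [RHS]qscaleE. Qed.

Lemma qbrPl (a : K) (x y z : lie_quot) :
  qbr (a *: x + y) z = a *: qbr x z + qbr y z.
Proof.
case: (lie_quot_surj x) => {}x ->; case: (lie_quot_surj y) => {}y ->;
  case: (lie_quot_surj z) => {}z ->;
  rewrite -lie_quot_scale -lie_quot_add !qbrE.
by rewrite -lie_quot_scale -lie_quot_add bracketPl.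
Qed.
Lemma qbrPr (a : K) (x y z : lie_quot) :
  qbr z (a *: x + y) = a *: qbr z x + qbr z y.
Proof.
case: (lie_quot_surj x) => {}x ->; case: (lie_quot_surj y) => {}y ->;
  case: (lie_quot_surj z) => {}z ->;
  rewrite -lie_quot_scale -lie_quot_add !qbrE.
by rewrite -lie_quot_scale -lie_quot_add bracketPr.
Qed.
Lemma qbrxx (x : lie_quot) : qbr x x = 0.
Proof. by case: (lie_quot_surj x) => {}x ->; rewrite qbrE bracketxx. Qed.
Lemma qjacobi (x y z : lie_quot) :
  qbr x (qbr y z) + qbr y (qbr z x) + qbr z (qbr x y) = 0.
Proof.
by case: (lie_quot_surj x) => {}x ->; case: (lie_quot_surj y) => {}y ->;
  case: (lie_quot_surj z) => {}z ->; rewrite !qbrE -!lie_quot_add jacobi.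
Qed.
HB.instance Definition _ := Lmodule_isLie.Build K lie_quot
  qbrPl qbrPr qbrxx qjacobi.

Definition lie_proj (x : L) : lie_quot := pi x.

End Quotient.

Definition is_gcm (n : nat) (A : 'M[int]_n) : Prop :=
  [/\ forall i, A i i = 2,
      forall i j, i != j -> A i j <= 0
    & forall i j, A i j = 0 -> A j i = 0].

(* Multiplicity of the arrow from node [i] to node [j] in the generalized
   Dynkin diagram of [A]; the value 0 means that there is no arrow. *)
Definition arrow_mult (n : nat) (A : 'M[int]_n) (i j : 'I_n) : int :=
  if i == j then 0 else - A j i.

Record realization (K : fieldType) (n : nat) (A : 'M[int]_n) := Realization {
  cartan : vectType K;
  coroot : 'I_n -> cartan;
  root : 'I_n -> 'Hom(cartan, K^o);
  dim_cartan : \dim {: cartan} = (n + (n - \rank (map_mx intr A : 'M[K]_n)))%N;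
  free_coroot : free [tuple coroot i | i < n];
  free_root : free [tuple root i | i < n];
  root_coroot : forall i j, root j (coroot i) = (A i j)%:~R
}.

Section KacMoody.
Variables (K : fieldType) (n : nat) (A : 'M[int]_n) (rz : realization K A).

Inductive km_gen : Type :=
  | HGen of cartan rz
  | EGen of 'I_n
  | FGen of 'I_n.

Local Notation h x := (LGen K (HGen x)).
Local Notation e i := (LGen K (EGen i)).
Local Notation f i := (LGen K (FGen i)).

(* [km_lin] makes the image of the Cartan space a quotient vector space of it:
   "generated by h" refers to h as a vector space, not as a bare set. *)
Inductive km_rel : lie_term K km_gen -> lie_term K km_gen -> Prop :=
  | km_lin a (x y : cartan rz) :
      km_rel (h (a *: x + y)) (LAdd (LScale a (h x)) (h y))
  | km_hh (x y : cartan rz) : km_rel (LBr (h x) (h y)) (LZero K km_gen)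
  | km_ef i j : km_rel (LBr (e i) (f j))
                  (if i == j then h (coroot rz i) else LZero K km_gen)
  | km_he (x : cartan rz) i :
      km_rel (LBr (h x) (e i)) (LScale (root rz i x : K) (e i))
  | km_hf (x : cartan rz) i :
      km_rel (LBr (h x) (f i)) (LScale (- (root rz i x : K)) (f i)).

Definition km_tilde : lieAlgType K := presented_lie km_rel.

Definition tilde_h (x : cartan rz) : km_tilde := lie_gen km_rel (HGen x).

(* There is only one such ideal; a maximal one exists by Zorn's lemma. *)
Definition km_radical (r : lie_ideal km_tilde) : Prop :=
  maximal_ideal_avoiding (range tilde_h) r.

Variable r : lie_ideal km_tilde.

Definition kac_moody : lieAlgType K := lie_quot r.

Definition km_h (x : cartan rz) : kac_moody := lie_proj r (tilde_h x).

Definition root_space (delta : 'Hom(cartan rz, K^o)) : set kac_moody :=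
  [set x | forall y : cartan rz, bracket (km_h y) x = (delta y : K) *: x].

Definition root_comb (c : 'I_n -> int) : 'Hom(cartan rz, K^o) :=
  \sum_(j < n) root rz j *~ c j.

(* The sum of the subspaces [root_space (root_comb c)] over all [c] with
   [c a = i]: each of them is closed under addition, so it is enough to take
   finite sums of their elements. *)
Definition grade_piece (a : 'I_n) (i : int) : set kac_moody :=
  [set x | exists s : seq kac_moody,
     (forall y, y \in s ->
        exists c : 'I_n -> int, c a = i /\ root_space (root_comb c) y)
     /\ x = \sum_(y <- s) y].

End KacMoody.

Arguments km_h {K n A rz} r x.
Arguments root_space {K n A rz} r delta.
Arguments grade_piece {K n A rz} r a i.

(* The subspace [U] of the possibly infinite-dimensional space [V] has a basis
   with [d] elements. *)
Definition has_dim (K : fieldType) (V : lmodType K) (U : set V) (d : nat) :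
    Prop :=
  exists b : 'I_d -> V,
    [/\ forall i, U (b i),
        forall c : 'I_d -> K, \sum_(i < d) c i *: b i = 0 -> forall i, c i = 0
      & forall x, U x -> exists c : 'I_d -> K, x = \sum_(i < d) c i *: b i].

(* Main.v *)
Require Import Defs.
From HB Require Import structures.
From mathcomp Require Import all_boot all_order all_algebra.
From mathcomp Require Import zify ring.
From mathcomp Require Import boolp classical_sets reals complex.

Set Implicit Arguments.
Unset Strict Implicit.
Unset Printing Implicit Defensive.

Import Order.TTheory GRing.Theory Num.Theory.
Local Open Scope ring_scope.

(** Put V = g_1, G = g_2 and d = dim V.  Since C(d,2) - (2d-3) = C(d-2,2) for
    d >= 2 (and G = 0 for d <= 1), it is enough to find a subspace V' of
    codimension 2 in V whose brackets still span G: the brackets of the pairs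
    of a basis of V' then number C(d-2,2).

    V is generated from v = e_a by the operators ad e_j (j <> a), and
    G = [V,V].  Grade V by height, the number of operators applied to v, so
    that V is the sum of V_0 = <v>, V_1, ..., V_M.  This is an eigenspace
    decomposition for an element of h, as the simple roots are linearly
    independent.  The subspace V' is obtained by cutting V at both ends.

    - At the bottom, let H be the sum of the V_m with m > 0.  No multiple arrow
      points to a, so [e_a,[e_a,e_j]] = 0 for j <> a.  The set of the x with
      [v,x] in [H,H] contains v, and it is stable under ad e_j because
      [v,[e_j,x]] = [e_j,[v,x]] - [[e_j,v],x], where [[e_j,v],v] = 0.  Hence
      [H,H] = G ([alt_span_positive]).

    - At the top, let T be the kernel of a nonzero functional that vanishes on
      V_m for m < M.  In fact [ker z, ker z] = G for every functional z <> 0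
      ([alt_span_hyperplane]).  Call z bad if this fails, that is, if some
      functional phi <> 0 on G vanishes on [ker z, ker z].  The automorphisms
      exp(t ad e_j) carry bad functionals to bad ones, and so does the limit
      for t to infinity ([degenerate_hyperplane]): if k is the largest integer
      with z o (ad e_j)^k <> 0, then that functional is bad too.  Iterating, a
      bad z degenerates to a bad functional killed by all ad e_j.  Its kernel
      contains H, which contradicts the first point.

    - Both cuts can be made together: put V' = H n T.  In heights > M of G the
      brackets of T already involve no element of V_0, and in heights <= M the
      brackets of H involve no element of V_M, so that [V',V'] = G
      ([dim_graded_image]).

    It remains to see that g_1 and g_2 are what was used.  The Lie algebra g is
    spanned by h and by the iterated brackets of the e_i, respectively of the
    f_i, so that for k > 0 the piece g_k is spanned by the iterated brackets of
    the e_i in which e_a occurs k times ([grade_pieceE]).  The Serre relation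
    holds because [e_a,[e_a,e_j]] is killed by all ad f_i: it generates an ideal
    made of brackets of the e_i, which meets h in 0 and thus vanishes by
    maximality of the radical ([singular_eq0], [serre_relation]). *)

(** * Eigenvectors, sums and functionals *)

Section Eigen.
Variables (K : fieldType) (L : lmodType K) (T : {linear L -> L}).

(** Applying T - mu_k removes the eigenvector for mu_k from the sum and scales
    z by the nonzero la - mu_k, which allows an induction on the sum. *)
Lemma eigen_sum_eq0 (J : Type) (s : seq J) (P : pred J) (x : J -> L)
    (mu : J -> K) la z :
  (forall j, P j -> T (x j) = mu j *: x j) -> (forall j, P j -> mu j != la) ->
  T z = la *: z -> z = \sum_(j <- s | P j) x j -> z = 0.
Proof.
move=> Tx ne; elim: s x z Tx => [|k s IHs] x z Tx Tz.
  by rewrite big_nil.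
rewrite big_cons; case: ifP => [Pk zE|_]; last exact: (IHs x).
have eq0 : (la - mu k) *: z = 0.
  apply: (IHs (fun j => (mu j - mu k) *: x j)).
  - by move=> j Pj; rewrite linearZ /= Tx // !scalerA mulrC.
  - by rewrite linearZ /= Tz !scalerA mulrC.
  - rewrite scalerBl -Tz zE linearD linear_sum /= Tx // scalerDr.
    rewrite opprD addrACA subrr add0r scaler_sumr -sumrB.
    by apply: eq_bigr => j Pj; rewrite Tx // scalerBl.
move/eqP: eq0; rewrite scaler_eq0 subr_eq0 eq_sym (negPf (ne k Pk)) /=.
by move/eqP.
Qed.

End Eigen.

Lemma sum_triangle (W : nmodType) (N : nat) (f : nat -> nat -> W) :
  (forall a b, (N <= a)%N -> f a b = 0) ->
  (forall a b, (N <= b)%N -> f a b = 0) ->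
  \sum_(n < N + N) \sum_(a < n.+1) f a (n - a)%N
  = \sum_(a < N) \sum_(b < N) f a b.
Proof.
move=> fa fb.
have -> : \sum_(n < N + N) \sum_(a < n.+1) f a (n - a)%N =
  \sum_(0 <= n < N + N) \sum_(0 <= a < N + N | (a < n.+1)%N) f a (n - a)%N.
  rewrite big_mkord; apply: eq_bigr => n _.
  by rewrite -(big_mkord xpredT (fun a => f a (n - a)%N)) (big_nat_widen _ _ (N + N)).
rewrite (exchange_big_dep_nat xpredT) //= (@big_cat_nat _ _ _ N) ?leq_addr //=.
rewrite [X in _ + X]big1_seq ?addr0; last first.
  move=> a; rewrite mem_index_iota /= => /andP[Na _]; apply: big1 => n _; exact: fa.
rewrite big_mkord; apply: eq_bigr => a _.
under eq_bigl do rewrite ltnS.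
rewrite -(big_mkord xpredT (f a)).
rewrite -(big_nat_widenl (val a) 0 (N + N) xpredT (fun n => f a (n - a)%N)) //.
rewrite -{1}[val a]add0n big_addn.
rewrite (@big_cat_nat _ _ _ N) //=; last first.
  by rewrite leq_subRL ?leq_add2r ltnW // ltn_addr.
rewrite [X in _ + X]big1_seq ?addr0; last first.
  move=> b; rewrite mem_index_iota /= => /andP[Nb _]; rewrite addnK; exact: fb.
by apply: eq_bigr => b _; rewrite addnK.
Qed.

Lemma linear_hom (K : fieldType) (U W : vectType K) (f : U -> W) :
  linear f -> exists g : 'Hom(U, W), g =1 f.
Proof.
move=> lf; pose fL := HB.pack f (GRing.isLinear.Build K U W *:%R f lf)
  : {linear U -> W}.
by exists (linfun fL) => x; rewrite lfunE.
Qed.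

(** The functional is a coordinate of the projection to a complement of U. *)
Lemma separating_functional (K : fieldType) (W : vectType K)
    (U : {vspace W}) : (U != fullv)%VS ->
  exists2 phi : 'Hom(W, K^o), phi != 0 & forall x, x \in U -> phi x = 0.
Proof.
move=> Uproper; pose u := vpick (U^C)%VS.
have u_neq0 : u != 0.
  rewrite vpick0; apply: contra Uproper => /eqP UC0.
  by rewrite -(addv_complf U) UC0 addv0.
have uC : u \in (U^C)%VS by exact: memv_pick.
have [i ui_neq0] : exists i, coord (vbasis (U^C)) i u != 0.
  apply/existsP; apply: contraR u_neq0; rewrite negb_exists => /forallP u0.
  rewrite (coord_vbasis uC) big1 // => i _.
  by have := u0 i; rewrite negbK => /eqP->; rewrite scale0r.
have [|phi phiE] := @linear_hom K W K^o
    (fun x => coord (vbasis (U^C)) i (x - projv U x)).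
  move=> c x y.
  have -> : c *: x + y - projv U (c *: x + y)
          = c *: (x - projv U x) + (y - projv U y).
    by rewrite linearP scalerBr opprD addrACA.
  by rewrite linearP.
exists phi.
  apply/eqP => phi0; move: ui_neq0; have := phiE u; rewrite phi0 zero_lfunE.
  have : u \in lker (projv U) by rewrite lker_proj.
  by rewrite memv_ker => /eqP->; rewrite subr0 => <-; rewrite eqxx.
by move=> x Ux; rewrite phiE projv_id // subrr linear0.
Qed.

(** * Alternating maps and degeneration of hyperplanes *)

Section AlternatingMap.
Variables (K : numFieldType) (V G : vectType K) (B : V -> V -> G).
Hypothesis B_linear_l : forall y, linear (B^~ y).
Hypothesis B_linear_r : forall x, linear (B x).
Hypothesis B_alt : forall x, B x x = 0.

Lemma alt_bDl x x' y : B (x + x') y = B x y + B x' y.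
Proof. by rewrite -{1}[x]scale1r [LHS](B_linear_l y) scale1r. Qed.
Lemma alt_bDr x y y' : B x (y + y') = B x y + B x y'.
Proof. by rewrite -{1}[y]scale1r B_linear_r scale1r. Qed.
Lemma alt_b0l y : B 0 y = 0.
Proof. by apply: (@addIr _ (B 0 y)); rewrite -alt_bDl !add0r. Qed.
Lemma alt_b0r x : B x 0 = 0.
Proof. by apply: (@addIr _ (B x 0)); rewrite -alt_bDr !add0r. Qed.
Lemma alt_bZl a x y : B (a *: x) y = a *: B x y.
Proof. by rewrite -[a *: x]addr0 [LHS](B_linear_l y) alt_b0l addr0. Qed.
Lemma alt_bZr a x y : B x (a *: y) = a *: B x y.
Proof. by rewrite -[a *: y]addr0 B_linear_r alt_b0r addr0. Qed.
Lemma alt_bC x y : B x y = - B y x.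
Proof.
apply/eqP; rewrite -addr_eq0; apply/eqP.
by have := B_alt (x + y); rewrite alt_bDl !alt_bDr !B_alt add0r addr0.
Qed.
Lemma alt_b_suml (J : Type) (s : seq J) (P : pred J) F y :
  B (\sum_(j <- s | P j) F j) y = \sum_(j <- s | P j) B (F j) y.
Proof.
apply: (big_morph (B^~ y)) => [x x'|]; [exact: alt_bDl | exact: alt_b0l].
Qed.
Lemma alt_b_sumr (J : Type) (s : seq J) (P : pred J) F x :
  B x (\sum_(j <- s | P j) F j) = \sum_(j <- s | P j) B x (F j).
Proof.
apply: (big_morph (B x)) => [y y'|]; [exact: alt_bDr | exact: alt_b0r].
Qed.

Definition alt_span (X : {vspace V}) : {vspace G} :=
  <<[seq B x y | x <- vbasis X, y <- vbasis X]>>%VS.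

Lemma mem_alt_span (X : {vspace V}) x y : x \in X -> y \in X -> B x y \in alt_span X.
Proof.
move=> /coord_vbasis-> /coord_vbasis->.
rewrite alt_b_suml; apply: memv_suml => i _; rewrite alt_bZl memvZ //.
rewrite alt_b_sumr; apply: memv_suml => j _; rewrite alt_bZr memvZ //.
apply: memv_span; apply/allpairsP.
by exists ((vbasis X)`_i, (vbasis X)`_j); rewrite /= !mem_nth ?size_tuple.
Qed.

Lemma alt_span_sub (X : {vspace V}) (U : {vspace G}) :
  (forall x y, x \in X -> y \in X -> B x y \in U) -> (alt_span X <= U)%VS.
Proof.
move=> BU; apply/span_subvP => _ /allpairsP[[x y] /= [xX yX ->]].
by apply: BU; exact: vbasis_mem.
Qed.

Lemma alt_spanS X Y : (X <= Y)%VS -> (alt_span X <= alt_span Y)%VS.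
Proof.
move=> /subvP XY; apply: alt_span_sub => x y xX yX.
by apply: mem_alt_span; exact: XY.
Qed.


Lemma dim_alt_span X : (\dim (alt_span X) <= 'C(\dim X, 2))%N.
Proof.
pose b := vbasis X; pose k := \dim X.
pose S := [seq B b`_p.1 b`_p.2
          | p : 'I_k * 'I_k <- enum [pred p : 'I_k * 'I_k | (p.1 < p.2)%N]].
have sizeS : size S = 'C(k, 2).
  rewrite size_map -cardE -sum1_card -bin2_sum big_mkord.
  rewrite (eq_bigr (fun j : 'I_k => \sum_(i < k | (i < j)%N) 1)%N); last first.
    move=> j _; rewrite -(big_ord_widen _ (fun=> 1%N)) ?(ltnW (ltn_ord j)) //.
    by rewrite sum1_card card_ord.
  rewrite (exchange_big_dep xpredT) //= pair_big_dep /=.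
  by apply: eq_bigl.
rewrite -sizeS; apply: leq_trans (dim_span S); apply: dimvS.
apply/span_subvP => _ /allpairsP[[x y] /= [/(nthP 0)[i ik <-] /(nthP 0)[j jk <-] ->]].
rewrite size_tuple in ik jk.
have lt_S (i' j' : 'I_k) : (i' < j')%N -> B b`_i' b`_j' \in <<S>>%VS.
  move=> ij; apply: memv_span; apply/mapP; exists (i', j') => //.
  by rewrite mem_enum.
case: (ltngtP i j) => [ij|ji|->]; last by rewrite B_alt mem0v.
- exact: (lt_S (Ordinal ik) (Ordinal jk)).
- by rewrite alt_bC memvN; exact: (lt_S (Ordinal jk) (Ordinal ik)).
Qed.


Lemma iter_linear (W : vectType K) (f : 'End(W)) n : linear (iter n f).
Proof. by move=> c x y; elim: n => //= n ->; rewrite linearP. Qed.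

Lemma derivation_iter (E : 'End(V)) (F : 'End(G)) n x y :
  (forall x y, F (B x y) = B (E x) y + B x (E y)) ->
  iter n F (B x y)
  = \sum_(a < n.+1) B (iter a E x) (iter (n - a) E y) *+ 'C(n, a).
Proof.
move=> dEF; elim: n x y => [|n IHn] x y; first by rewrite big_ord1 bin0.
rewrite iterSr dEF.
have [h hE] := linear_hom (iter_linear F n).
have -> : iter n F (B (E x) y + B x (E y))
        = iter n F (B (E x) y) + iter n F (B x (E y)).
  by rewrite -!hE linearD.
rewrite !IHn.
rewrite [X in _ + X]big_ord_recl [RHS]big_ord_recl /= !bin0 !subn0 -iterSr.
rewrite addrCA; congr (_ + _).
transitivity (\sum_(i < n.+1) (B (iter i E (E x)) (iter (n - i) E y) *+ 'C(n, i)
   + B (iter i.+1 E x) (iter (n - i) E y) *+ 'C(n, i.+1))).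
  rewrite big_split /=; congr (_ + _); rewrite [RHS]big_ord_recr /=.
  rewrite bin_small // mulr0n addr0; apply: eq_bigr => i _ /=.
  by rewrite -iterSr subnSK.
apply: eq_bigr => i _; rewrite subSS.
by rewrite -iterSr binS mulrnDr addrC.
Qed.

Lemma nat_fact_neq0 n : n`!%:R != 0 :> K.
Proof. by rewrite pnatr_eq0 -lt0n fact_gt0. Qed.

Lemma poly_natr_eq0 (p : {poly K}) : (forall t : K, p.[t] = 0) -> p = 0.
Proof.
move=> p0; apply/eqP; apply: contraT => p_neq0.
have := max_poly_roots p_neq0 (rs := [seq i%:R | i <- iota 0 (size p)]).
rewrite size_map size_iota ltnn => -> //.
  by apply/allP => t _; apply/rootP.
by rewrite map_inj_uniq ?iota_uniq // => i j /eqP; rewrite eqr_nat => /eqP.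
Qed.

(** The limit argument.  Let z(t) = z o exp(tE) and phi(t) = phi o exp(tF).  As
    exp(tE) and exp(tF) are compatible with B, phi(t) vanishes on the B p q with
    p, q in ker z(t).  For p, q in ker z' and w outside, z(t)(w) p - z(t)(p) w
    and z(t)(w) q - z(t)(q) w are in ker z(t).  This gives a polynomial identity
    in t, in which the coefficients z(t)(p) and z(t)(q) have smaller degree than
    z(t)(w).  Its leading coefficient says that the leading coefficient phi_n
    of phi(t) vanishes on B p q. *)
Lemma degenerate_hyperplane (E : 'End(V)) (F : 'End(G)) (N k : nat)
    (z z' : 'Hom(V, K^o)) :
  (forall x y, F (B x y) = B (E x) y + B x (E y)) ->
  (forall a x, (N <= a)%N -> iter a E x = 0) ->
  alt_span fullv = fullv ->
  z' != 0 -> (forall x, z' x = z (iter k E x)) ->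
  (forall a x, (k < a)%N -> z (iter a E x) = 0) ->
  alt_span (lker z) != fullv -> alt_span (lker z') != fullv.
Proof.
move=> dEF nilE BV z'_neq0 z'E z_top /separating_functional[phi phi_neq0 phi0].
apply/eqP => Bz'.
pose c (a : nat) : K := (a`!%:R)^-1.
pose expE t x := \sum_(a < N) (t ^+ a * c a) *: iter a E x.
pose expF t g := \sum_(n < N + N) (t ^+ n * c n) *: iter n F g.
have expB t x y : expF t (B x y) = B (expE t x) (expE t y).
  pose f a b := B ((t ^+ a * c a) *: iter a E x) ((t ^+ b * c b) *: iter b E y).
  have -> : B (expE t x) (expE t y) = \sum_(a < N) \sum_(b < N) f a b.
    by rewrite alt_b_suml; apply: eq_bigr => a _; rewrite alt_b_sumr.
  rewrite -sum_triangle => [|a b Na|a b Nb]; first last.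
  - by rewrite /f (nilE b) // scaler0 alt_b0r.
  - by rewrite /f (nilE a) // scaler0 alt_b0l.
  apply: eq_bigr => n _; rewrite (derivation_iter _ _ _ dEF) scaler_sumr.
  apply: eq_bigr => a _; rewrite /f alt_bZl alt_bZr scalerA.
  rewrite -scaler_nat scalerA; congr (_ *: _).
  have an : (a <= n)%N by rewrite -ltnS.
  rewrite mulrACA -exprD subnKC // -mulrA; congr (_ * _).
  have bin_neq0 : 'C(n, a)%:R != 0 :> K by rewrite pnatr_eq0 -lt0n bin_gt0.
  by rewrite /c -(bin_fact an) !natrM; field; rewrite bin_neq0 !nat_fact_neq0.
have nilF n g : (N + N <= n)%N -> iter n F g = 0.
  move=> Nn; have [h hE] := linear_hom (iter_linear F n).
  suff : g \in lker h by rewrite memv_ker hE => /eqP.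
  have : g \in alt_span fullv by rewrite BV memvf.
  apply/subvP; apply: alt_span_sub => x y _ _.
  rewrite memv_ker hE (derivation_iter _ _ _ dEF) big1 // => a _.
  have [Na|aN] := leqP N a; first by rewrite nilE // alt_b0l mul0rn.
  by rewrite [X in B _ X]nilE ?alt_b0r ?mul0rn // leq_subRL; lia.
have [w w_neq0] : exists w, z' w != 0.
  by move/lfunPn: z'_neq0 => [w]; rewrite zero_lfunE; exists w.
have [n phi_n phi_top] : exists2 n, exists g, phi (iter n F g) != 0
    & forall m g, (n < m)%N -> phi (iter m F g) = 0.
  pose P n := `[< exists g, phi (iter n F g) != 0 >].
  have exP : exists n, P n.
    exists 0; apply/asboolP.
    by move/lfunPn: phi_neq0 => [g]; rewrite zero_lfunE; exists g.
  have leP n : P n -> (n <= N + N)%N.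
    rewrite leqNgt => /asboolP[g]; apply: contraNN => Nn.
    by rewrite nilF ?linear0 // ltnW.
  case: (ex_maxnP exP leP) => n /asboolP Pn n_max; exists n => // m g.
  rewrite ltnNge; apply: contraNeq => pm; apply: n_max.
  by apply/asboolP; exists g.
(* The polynomials in t that represent z(t)(x) and phi(t)(g). *)
pose Z x := \poly_(a < N) (z (iter a E x) * c a : K).
pose Ph g := \poly_(n < N + N) (phi (iter n F g) * c n : K).
have hornerZ t x : (Z x).[t] = z (expE t x).
  rewrite horner_poly linear_sum; apply: eq_bigr => a _.
  by rewrite linearZ -mulrA mulrC [c a * _]mulrC.
have hornerPh t g : (Ph g).[t] = phi (expF t g).
  rewrite horner_poly linear_sum; apply: eq_bigr => a _.
  by rewrite linearZ -mulrA mulrC [c a * _]mulrC.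
have kN : (k < N)%N.
  rewrite ltnNge; apply: contra w_neq0 => Nk.
  by rewrite z'E nilE // linear0.
have nNN : (n < N + N)%N.
  case: phi_n => g; rewrite ltnNge; apply: contraNN => Nn.
  by rewrite nilF // linear0.
have coefZ x a : (Z x)`_a = z (iter a E x) * c a.
  rewrite coef_poly; case: ltnP => // Na.
  by rewrite nilE // linear0 [RHS]mul0r.
have coefPh g a : (Ph g)`_a = phi (iter a F g) * c a.
  rewrite coef_poly; case: ltnP => // Na.
  by rewrite nilF // linear0 [RHS]mul0r.
have c_neq0 a : c a != 0 by rewrite invr_neq0 ?nat_fact_neq0.
have sizeZw : size (Z w) = k.+1.
  apply/eqP; rewrite eqn_leq; apply/andP; split.
    by apply/leq_sizeP => a ka; rewrite coefZ z_top ?[LHS]mul0r.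
  rewrite ltnNge; apply/negP => /leq_sizeP/(_ k (leqnn k))/eqP.
  by rewrite coefZ -z'E mulf_eq0 (negPf w_neq0) (negPf (c_neq0 _)).
have sizeZ x : z' x = 0 -> (size (Z x) <= k)%N.
  move=> z'x; apply/leq_sizeP => a; rewrite coefZ leq_eqVlt.
  by case/predU1P => [<-|ka]; rewrite -?z'E ?z'x ?z_top ?[LHS]mul0r.
have sizePh g : (size (Ph g) <= n.+1)%N.
  by apply/leq_sizeP => a na; rewrite coefPh phi_top ?[LHS]mul0r.
suff phi_nB p q : z' p = 0 -> z' q = 0 -> phi (iter n F (B p q)) = 0.
  case: phi_n => g /eqP[]; have [h hE] := linear_hom (iter_linear F n).
  have : g \in lker (phi \o h)%VF.
    have : g \in alt_span (lker z') by rewrite Bz' memvf.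
    apply/subvP; apply: alt_span_sub => x y; rewrite !memv_ker.
    by move=> /eqP z'x /eqP z'y; rewrite comp_lfunE hE phi_nB.
  by rewrite memv_ker comp_lfunE hE => /eqP.
move=> z'p z'q.
(* The term z(t)(p) z(t)(q) phi(t)(B w w) drops out, so z(t)(w) is a factor. *)
have key : Z w * (Z w * Ph (B p q) - Z q * Ph (B p w) - Z p * Ph (B w q)) = 0.
  apply: poly_natr_eq0 => t; rewrite !(hornerM, hornerD, hornerN).
  rewrite !hornerZ !hornerPh.
  set a : K := z (expE t w); set b : K := z (expE t p).
  set d : K := z (expE t q).
  have expE_lin u s : expE t (u *: s) = u *: expE t s.
    rewrite scaler_sumr; apply: eq_bigr => i _.
    have [h hE] := linear_hom (iter_linear E i).
    by rewrite -!hE linearZ !scalerA mulrC.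
  have expED s s' : expE t (s + s') = expE t s + expE t s'.
    rewrite -big_split /=; apply: eq_bigr => i _.
    have [h hE] := linear_hom (iter_linear E i).
    by rewrite -!hE linearD scalerDr.
  have in_ker s : z (expE t (a *: s + (- (z (expE t s) : K)) *: w)) = 0.
    rewrite expED !expE_lin linearD !linearZ /=.
    set u : K := z (expE t s).
    by rewrite [LHS]/(a * u + - u * a) mulNr [u * a]mulrC; exact: subrr.
  have := phi0 (B (expE t (a *: p + (- b) *: w)) (expE t (a *: q + (- d) *: w))).
  rewrite mem_alt_span ?memv_ker ?in_ker // => /(_ isT).
  rewrite !expED !expE_lin alt_bDl !alt_bDr !alt_bZl !alt_bZr B_alt !scaler0.
  rewrite addr0 -!expB !scalerA !linearD !linearZ /= => <-.
  have expand (r s u : K) :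
    a * (a * r - d * s - b * u) = a * a * r + a * - d * s + - b * a * u by ring.
  exact: expand.
have Zw_neq0 : Z w != 0 by rewrite -size_poly_gt0 sizeZw.
move/eqP: key; rewrite mulf_eq0 (negPf Zw_neq0) /= -addrA -opprD subr_eq0.
move=> /eqP key; apply/eqP; apply: contraT => phi_pq.
have sizePq : size (Ph (B p q)) = n.+1.
  apply/eqP; rewrite eqn_leq sizePh ltnNge.
  apply/negP => /leq_sizeP/(_ n (leqnn n))/eqP.
  by rewrite coefPh mulf_eq0 (negPf phi_pq) (negPf (c_neq0 _)).
have : (size (Z w * Ph (B p q))%R <= k + n)%N.
  rewrite key; apply: leq_trans (size_polyD _ _) _; rewrite geq_max.
  apply/andP; split; apply: leq_trans (size_polyMleq _ _) _.
    by have := sizeZ q z'q; have := sizePh (B p w); lia.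
  by have := sizeZ p z'p; have := sizePh (B w q); lia.
rewrite size_mul // ?sizeZw ?sizePq -?size_poly_gt0 ?sizePq //.
by rewrite addSn addnS /= ltnn.
Qed.
End AlternatingMap.

(** * Graded spaces generated by one vector *)

Section NatEigenspaces.
Variables (K : numFieldType) (W : vectType K) (f : 'End(W)).

Definition nat_eigenspace (m : nat) := lker (f - (m%:R : K) *: \1%VF).

Lemma mem_nat_eigenspace m x : (x \in nat_eigenspace m) = (f x == m%:R *: x).
Proof.
by rewrite memv_ker add_lfunE opp_lfunE scale_lfunE id_lfunE subr_eq0.
Qed.

Lemma nat_eigenspace_sum_cap n (P : pred 'I_n) m x :
  (forall i, P i -> val i != m) ->
  x \in (\sum_(i < n | P i) nat_eigenspace i)%VS -> x \in nat_eigenspace m ->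
  x = 0.
Proof.
move=> Pm /memv_sumP[y Vy ->]; rewrite mem_nat_eigenspace => /eqP xm.
apply: (eigen_sum_eq0 _ _ xm (erefl _) (mu := fun i : 'I_n => i%:R)).
  by move=> i /Vy; rewrite mem_nat_eigenspace => /eqP.
by move=> i /Pm; rewrite eqr_nat.
Qed.

Lemma directv_nat_eigenspace n :
  directv (\sum_(i < n) nat_eigenspace i)%VS.
Proof.
apply/directv_sumP => i _; apply/eqP; rewrite -subv0; apply/subvP => x.
rewrite memv_cap memv0 => /andP[xi xs].
apply/eqP; apply: (nat_eigenspace_sum_cap _ xs xi).
by move=> j /andP[_]; rewrite -val_eqE.
Qed.

Lemma nat_eigenspace_disjoint n (P Q : pred 'I_n) x :
  (forall i, P i -> ~~ Q i) ->
  x \in (\sum_(i < n | P i) nat_eigenspace i)%VS ->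
  x \in (\sum_(i < n | Q i) nat_eigenspace i)%VS -> x = 0.
Proof.
move=> PQ /memv_sumP[a Va ->] /memv_sumP[b Vb eq_ab].
apply: big1 => i Pi.
apply: (@nat_eigenspace_sum_cap n (fun j => j != i) i); last exact: Va.
  by move=> j; rewrite -val_eqE.
have -> : a i = \sum_(j | Q j) b j - \sum_(j | P j && (j != i)) a j.
  by rewrite -eq_ab (bigD1 i) //= addrK.
rewrite memvB //; apply: memv_suml => j.
  move=> Qj; apply/(subvP (sumv_sup j _ (subvv _))); last exact: Vb.
  by apply: contraTneq Qj => ->; exact: PQ.
move=> /andP[Pj ji]; apply/(subvP (sumv_sup j _ (subvv _))) => //.
exact: Va.
Qed.

End NatEigenspaces.

(** Here V and G stand for g_1 and g_2 with B the bracket; E i and F i are the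
    actions of ad e_i on them, and D and DG the height operators. *)
Section GradedGeneration.
Variables (K : numFieldType) (V G : vectType K) (B : V -> V -> G).
Hypothesis B_linear_l : forall y, linear (B^~ y).
Hypothesis B_linear_r : forall x, linear (B x).
Hypothesis B_alt : forall x, B x x = 0.
Variables (I : finType) (E : I -> 'End(V)) (F : I -> 'End(G)).
Variables (D : 'End(V)) (DG : 'End(G)) (v : V).
Hypothesis F_deriv : forall i x y, F i (B x y) = B (E i x) y + B x (E i y).
Hypothesis D_deriv : forall x y, DG (B x y) = B (D x) y + B x (D y).
Hypothesis D_E : forall i x, D (E i x) = E i x + E i (D x).
Hypothesis D_v : D v = 0.
Hypothesis B_v_Ev : forall i, B v (E i v) = 0.
Hypothesis V_gen : forall U : {vspace V}, v \in U ->
  (forall i x, x \in U -> E i x \in U) -> U = fullv.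
Hypothesis G_span : alt_span B fullv = fullv.

Local Notation Vm := (nat_eigenspace D).
Local Notation Gm := (nat_eigenspace DG).

Lemma raise_eigen i m x : x \in Vm m -> E i x \in Vm m.+1.
Proof.
rewrite !mem_nat_eigenspace => /eqP xm.
by rewrite D_E xm linearZ /= -add1n natrD scalerDl scale1r.
Qed.

Lemma v_eigen : v \in Vm 0.
Proof. by rewrite mem_nat_eigenspace D_v scale0r. Qed.

Lemma raise_eigen_iter i m a x : x \in Vm m -> iter a (E i) x \in Vm (m + a).
Proof.
move=> xm; elim: a => [|a IHa]; first by rewrite addn0.
by rewrite addnS /= raise_eigen.
Qed.

Lemma B_eigen m p x y : x \in Vm m -> y \in Vm p -> B x y \in Gm (m + p).
Proof.
rewrite !mem_nat_eigenspace => /eqP xm /eqP yp.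
by rewrite D_deriv xm yp (alt_bZl B_linear_l) (alt_bZr B_linear_r) -scalerDl -natrD.
Qed.

(** E i maps height m to height m + 1.  As V is finite-dimensional, some height
    N is absent, so that the sum of the heights below N is stable and contains
    v: it is V. *)
Lemma eigen_decomposition : exists N,
  [/\ forall m, (N <= m)%N -> Vm m = 0%VS, forall m, (m < N)%N -> Vm m != 0%VS
    & (\sum_(m < N) Vm m)%VS = fullv].
Proof.
have ex0 : exists m, Vm m == 0%VS.
  pose d := \dim {:V}.
  suff /existsP[i Vi0] : [exists i : 'I_d.+1, Vm i == 0%VS] by exists i.
  apply: contraT; rewrite negb_exists => /forallP Vneq0.
  have /directvP /= dimE := directv_nat_eigenspace D d.+1.
  have : (d.+1 <= \sum_(i < d.+1) \dim (Vm i))%N.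
    rewrite -{1}[d.+1]card_ord -sum1_card; apply: leq_sum => i _.
    by rewrite lt0n dimv_eq0.
  by rewrite -dimE leqNgt ltnS dimvS ?subvf.
case: (ex_minnP ex0) => N /eqP VN0 N_min; exists N.
have Vfull : (\sum_(m < N) Vm m)%VS = fullv.
  apply: V_gen.
    case: N N_min VN0 => [|N] _ VN0; last first.
      by apply/(subvP (sumv_sup ord0 _ (subvv _))) => //; exact: v_eigen.
    by have := v_eigen; rewrite VN0 memv0 => /eqP->; exact: mem0v.
  move=> i x /memv_sumP[y Vy ->]; rewrite linear_sum /=; apply: memv_suml => m _.
  have := raise_eigen i (Vy m isT).
  have [mN|] := ltnP m.+1 N.
    by apply/subvP; exact: (sumv_sup (Ordinal mN)).
  move=> Nm; have -> : m.+1 = N by apply/eqP; rewrite eqn_leq ltn_ord.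
  by rewrite VN0 memv0 => /eqP->; exact: mem0v.
split=> // m.
  move=> Nm; apply/eqP; rewrite -subv0; apply/subvP => x xm; rewrite memv0.
  apply/eqP; apply: (@nat_eigenspace_sum_cap _ _ D N xpredT m) => //.
    by move=> i _; rewrite ltn_eqF // (leq_trans (ltn_ord i)).
  by rewrite Vfull memvf.
by rewrite ltnNge; apply: contraNneq => Vm0; rewrite N_min ?Vm0.
Qed.

Lemma raise_sum_eigen N i x : (forall m, (N <= m)%N -> Vm m = 0%VS) ->
  x \in (\sum_(m < N) Vm m)%VS -> E i x \in (\sum_(m < N | (0 < m)%N) Vm m)%VS.
Proof.
move=> V_0 /memv_sumP[y Vy ->]; rewrite linear_sum /=.
apply: memv_suml => m _; have := raise_eigen i (Vy m isT).
have [mN|Nm] := ltnP m.+1 N.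
  by apply/subvP; exact: (sumv_sup (Ordinal mN)).
by rewrite V_0 // memv0 => /eqP->; exact: mem0v.
Qed.

Section Decomposed.
Variable N : nat.
Hypothesis V_big : forall m, (N <= m)%N -> Vm m = 0%VS.
Hypothesis V_sum : (\sum_(m < N) Vm m)%VS = fullv.

Let H := (\sum_(m < N | (0 < m)%N) Vm m)%VS.

Lemma raise_positive i x : E i x \in H.
Proof. by apply: raise_sum_eigen => //; rewrite V_sum memvf. Qed.

Lemma v_plus_images : (<[v]> + \sum_i limg (E i))%VS = fullv.
Proof.
apply: V_gen => [|i x _].
  by apply/(subvP (addvSl _ _)); exact: memv_line.
apply/(subvP (addvSr _ _)); apply/(subvP (sumv_sup i _ (subvv _))) => //.
by apply: memv_img; exact: memvf.
Qed.

(** V is spanned by v and the images of the E i; the latter have positive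
    height, so an element of positive height has no component along v. *)
Lemma positive_images : H = (\sum_i limg (E i))%VS.
Proof.
have imH : (\sum_i limg (E i) <= H)%VS.
  apply/subv_sumP => i _; apply/subvP => _ /memv_imgP[x _ ->].
  exact: raise_positive.
apply/eqP; rewrite eqEsubv imH andbT; apply/subvP => p pH.
have /memv_addP[_ /vlineP[c ->] [h him pE]] : p \in (<[v]> + \sum_i limg (E i))%VS.
  by rewrite v_plus_images memvf.
suff cv0 : c *: v = 0 by rewrite pE cv0 add0r.
apply: (@nat_eigenspace_sum_cap _ _ D N (fun m => 0 < m)%N 0).
- by move=> i; rewrite lt0n.
- have -> : c *: v = p - h by rewrite pE addrK.
  by rewrite memvB //; apply: (subvP imH).
- by rewrite memvZ // v_eigen.
Qed.

(** The vectors x with B v x in the span of B(H,H) contain v and are stable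
    under E i, since B v (E i x) = F i (B v x) - B (E i v) x, and the part of x
    along v does not contribute to the last term by B_v_Ev. *)
Lemma alt_span_positive : alt_span B H = fullv.
Proof.
have F_stable i g : g \in alt_span B H -> F i g \in alt_span B H.
  rewrite memv_preim; apply/subvP; apply: alt_span_sub => x y xH yH.
  rewrite -memv_preim F_deriv memvD // mem_alt_span //; exact: raise_positive.
have [Bv BvE] := linear_hom (B_linear_r v).
have v_good x : B v x \in alt_span B H.
  rewrite -BvE memv_preim; set U := (Bv @^-1: _)%VS.
  suff -> : U = fullv by exact: memvf.
  apply: V_gen => [|i y]; rewrite /U -!memv_preim !BvE.
    by rewrite B_alt mem0v.
  move=> Bvy; have -> : B v (E i y) = F i (B v y) - B (E i v) y.
    by rewrite F_deriv addrC addKr.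
  apply: memvB; first exact: F_stable.
  have : y \in (<[v]> + \sum_i limg (E i))%VS by rewrite v_plus_images memvf.
  case/memv_addP => _ /vlineP[c ->] [h him ->].
  rewrite (alt_bDr B_linear_r) (alt_bZr B_linear_r).
  rewrite (alt_bC B_linear_l B_linear_r B_alt (E i v) v) B_v_Ev oppr0 scaler0 add0r.
  by apply: mem_alt_span; rewrite ?raise_positive ?positive_images.
apply/eqP; rewrite eqEsubv subvf -G_span.
apply: alt_span_sub => x y _ _.
have : x \in (<[v]> + H)%VS by rewrite positive_images v_plus_images memvf.
have : y \in (<[v]> + H)%VS by rewrite positive_images v_plus_images memvf.
case/memv_addP => _ /vlineP[c ->] [h hH ->].
case/memv_addP => _ /vlineP[c' ->] [h' hH' ->].
rewrite (alt_bDl B_linear_l) (alt_bZl B_linear_l) memvD ?memvZ //.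
rewrite (alt_bDr B_linear_r) (alt_bZr B_linear_r).
rewrite memvD ?mem_alt_span // memvZ //.
by rewrite (alt_bC B_linear_l B_linear_r B_alt) memvN.
Qed.

Lemma raise_nilpotent i a x : (N <= a)%N -> iter a (E i) x = 0.
Proof.
move=> Na; have [h hE] := linear_hom (iter_linear (E i) a).
have /memv_sumP[y Vy ->] : x \in (\sum_(m < N) Vm m)%VS by rewrite V_sum memvf.
rewrite -hE linear_sum big1 //= => m _; apply/eqP.
rewrite hE -memv0 -(V_big (m := m + a)%N) ?raise_eigen_iter ?Vy //.
by rewrite (leq_trans Na) ?leq_addl.
Qed.

(** Induction on a bound s such that z vanishes in heights >= s.  If some
    z o E i is nonzero, the degeneration of z along E i vanishes in heights
    >= s - 1.  Otherwise the kernel of z contains H. *)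
Lemma alt_span_hyperplane (z : 'Hom(V, K^o)) :
  z != 0 -> alt_span B (lker z) = fullv.
Proof.
have vanish s : forall z : 'Hom(V, K^o), z != 0 ->
    (forall m x, (s <= m)%N -> x \in Vm m -> z x = 0) ->
    alt_span B (lker z) = fullv.
  elim: s => [|s IHs] {}z z_neq0 z_top.
    case/eqP: z_neq0; apply/lfunP => x; rewrite zero_lfunE.
    have /memv_sumP[y Vy ->] : x \in (\sum_(m < N) Vm m)%VS by rewrite V_sum memvf.
    by rewrite linear_sum big1 // => m _; apply: (z_top m); rewrite ?Vy.
  have [/existsP[i zEi]|] := boolP [exists i, (z \o E i)%VF != 0]; last first.
    rewrite negb_exists => /forallP zE.
    apply/eqP; rewrite eqEsubv subvf -alt_span_positive; apply: alt_spanS => //.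
    rewrite positive_images; apply/subv_sumP => i _; apply/subvP => _ /memv_imgP[x _ ->].
    rewrite memv_ker -comp_lfunE; have := zE i.
    by rewrite negbK => /eqP->; rewrite zero_lfunE.
  pose P a := `[< exists x, z (iter a (E i) x) != 0 >].
  have P1 : P 1.
    by apply/asboolP; move/lfunPn: zEi => [x]; rewrite zero_lfunE comp_lfunE; exists x.
  have P_le a : P a -> (a <= N)%N.
    rewrite leqNgt => /asboolP[x]; apply: contraNN => Na.
    by rewrite raise_nilpotent ?linear0 // ltnW.
  case: (ex_maxnP (ex_intro P 1%N P1) P_le) => k /asboolP[w w_neq0] k_max.
  have [h hE] := linear_hom (iter_linear (E i) k).
  pose z' := (z \o h)%VF.
  have z'E x : z' x = z (iter k (E i) x) by rewrite comp_lfunE hE.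
  have z'_neq0 : z' != 0.
    by apply: contraNneq w_neq0 => z'0; rewrite -z'E z'0 zero_lfunE.
  apply/eqP; apply: contraT => bad_z.
  have /eqP[] : alt_span B (lker z') != fullv; last first.
    apply: IHs => // m x sm xm; rewrite z'E; apply: (z_top (m + k)%N).
      by have := k_max 1%N P1; lia.
    exact: raise_eigen_iter.
  apply: (degenerate_hyperplane B_linear_l B_linear_r B_alt (F_deriv i)
            (@raise_nilpotent i) G_span z'_neq0 z'E _ bad_z) => a x ka.
  apply/eqP; apply: contraTT ka => za; rewrite -leqNgt; apply: k_max.
  by apply/asboolP; exists x.
move=> z_neq0; apply: (vanish N) => // m x Nm.
by rewrite V_big // memv0 => /eqP->; rewrite linear0.
Qed.

End Decomposed.

(** H omits the bottom height and T one direction of the top height M = N - 1.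
    Every homogeneous B x y with x, y in T of total height >= N has both x and y
    in H; every one with x, y in H of total height < N has both in T.  With A
    and C the sums of the heights below N and from N on in G, and U the span of
    B on H n T, this gives G = A + (U n C) = (U n A) + C, whence G = U. *)
Theorem dim_graded_image : (\dim {:G} <= 'C((\dim {:V}).-2, 2))%N.
Proof.
have [small|big] := leqP (\dim {:V}) 1.
  rewrite -G_span (leq_trans (dim_alt_span B_linear_l B_linear_r B_alt _)) //.
  by rewrite !bin_small //; case: (\dim _) small => [|[|]].
have [N [V_big V_neq0 V_sum]] := eigen_decomposition.
pose H := (\sum_(m < N | (0 < m)%N) Vm m)%VS.
have v_neq0 : v != 0.
  apply: contraTneq big => v0; rewrite -leqNgt.
  have <- : (0 : {vspace V})%VS = fullv; last by rewrite dimv0.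
  apply: V_gen => [|i x]; rewrite ?v0 ?mem0v //.
  by rewrite memv0 => /eqP->; rewrite linear0 mem0v.
have N_gt1 : (1 < N)%N.
  rewrite ltnNge; apply: contraL big => N1; rewrite -leqNgt.
  have <- : <[v]>%VS = fullv; last by rewrite dim_vline v_neq0.
  apply: V_gen => [|i _ /vlineP[c ->]]; first exact: memv_line.
  have := raise_eigen i v_eigen; rewrite V_big // linearZ /= memv0 => /eqP->.
  by rewrite scaler0 mem0v.
have [M NE] : exists M, N = M.+1 by exists N.-1; rewrite prednK // ltnW.
have V_top_cap x : x \in Vm M -> x \in (\sum_(m < N | (m < M)%N) Vm m)%VS -> x = 0.
  move=> xM xs; apply: (nat_eigenspace_sum_cap _ xs xM) => i /=.
  by move=> iM; rewrite ltn_eqF.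
have M_neq0 : (0 < M)%N by rewrite -ltnS -NE.
have [|eta eta_neq0 eta_low] :=
    @separating_functional _ _ (\sum_(m < N | (m < M)%N) Vm m)%VS.
  apply: contra (V_neq0 M _) => [/eqP Vlow|]; last by rewrite NE.
  rewrite -subv0; apply/subvP => x xM; rewrite memv0.
  by apply/eqP; apply: V_top_cap => //; rewrite Vlow memvf.
pose T := lker eta.
have low_T m x : (m < M)%N -> x \in Vm m -> x \in T.
  move=> mM xm; rewrite memv_ker eta_low //.
  have mN : (m < N)%N by rewrite NE ltnS ltnW.
  by apply/(subvP (sumv_sup (Ordinal mN) _ (subvv _))).
have high_H m x : (0 < m)%N -> x \in Vm m -> x \in H.
  move=> m0 xm; have [mN|/V_big Vm0] := ltnP m N.
    by apply/(subvP (sumv_sup (Ordinal mN) _ (subvv _))).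
  by move: xm; rewrite Vm0 memv0 => /eqP->; exact: mem0v.
have BT : alt_span B T = fullv by exact: (alt_span_hyperplane V_big V_sum).
have BH : alt_span B H = fullv by exact: (alt_span_positive V_big V_sum).
pose U := alt_span B (H :&: T).
pose A := (\sum_(k < N + N | (k < N)%N) Gm k)%VS.
pose C := (\sum_(k < N + N | (N <= k)%N) Gm k)%VS.
have mem_A m x : (m < N)%N -> x \in Gm m -> x \in A.
  move=> mN; have mNN : (m < N + N)%N by rewrite ltn_addr.
  by apply/subvP; exact: (sumv_sup (Ordinal mNN)).
have mem_C m x : (N <= m < N + N)%N -> x \in Gm m -> x \in C.
  by move=> /andP[Nm mNN]; apply/subvP; exact: (sumv_sup (Ordinal mNN)).
have T_comp x : x \in T -> exists2 y : 'I_N -> V,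
    (forall m, y m \in Vm m /\ y m \in T) & x = \sum_(m < N) y m.
  move=> xT; have : x \in (\sum_(m < N) Vm m)%VS by rewrite V_sum memvf.
  case/memv_sumP => y Vy xE; exists y => // m; split; first exact: Vy.
  have [mM|Mm] := ltnP m M; first by apply: (low_T m) => //; exact: Vy.
  have mE : m = M :> nat by have := ltn_ord m; lia.
  have -> : y m = x - \sum_(j < N | j != m) y j by rewrite xE (bigD1 m) //= addrK.
  rewrite memvB //; apply: memv_suml => j jm; apply: (low_T j); last exact: Vy.
  have jM : val j != M by rewrite -mE val_eqE.
  by have := ltn_ord j; move: jM => /=; lia.
have GA : (A + (U :&: C))%VS = fullv.
  apply/eqP; rewrite eqEsubv subvf -BT; apply: alt_span_sub => x y.
  case/T_comp => xs Vxs -> /T_comp[ys Vys ->].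
  rewrite (alt_b_suml B_linear_l); apply: memv_suml => m _.
  rewrite (alt_b_sumr B_linear_r); apply: memv_suml => p _.
  have [[xm xT] [yp yT]] := (Vxs m, Vys p).
  have Bxy := B_eigen xm yp.
  have [mp|mp] := ltnP (m + p)%N N.
    by apply/(subvP (addvSl _ _)); exact: mem_A Bxy.
  apply/(subvP (addvSr _ _)); rewrite memv_cap (mem_C _ _ _ Bxy) ?andbT; last first.
    by have := ltn_ord m; have := ltn_ord p; lia.
  apply: mem_alt_span => //; rewrite memv_cap ?xT ?yT andbT.
    by apply: high_H xm; have := ltn_ord p; lia.
  by apply: high_H yp; have := ltn_ord m; lia.
have GC : ((U :&: A) + C)%VS = fullv.
  apply/eqP; rewrite eqEsubv subvf -BH; apply: alt_span_sub => x y.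
  case/memv_sumP => xs Vxs -> /memv_sumP[ys Vys ->].
  rewrite (alt_b_suml B_linear_l); apply: memv_suml => m m_gt0.
  rewrite (alt_b_sumr B_linear_r); apply: memv_suml => p p_gt0.
  have [xm yp] := (Vxs m m_gt0, Vys p p_gt0).
  have Bxy := B_eigen xm yp.
  have [mp|mp] := ltnP (m + p)%N N; last first.
    apply/(subvP (addvSr _ _)); apply: mem_C Bxy.
    by have := ltn_ord m; have := ltn_ord p; lia.
  apply/(subvP (addvSl _ _)); rewrite memv_cap (mem_A _ _ mp Bxy) andbT.
  apply: mem_alt_span => //; rewrite memv_cap.
    by rewrite (high_H _ _ m_gt0 xm) (low_T m) //; lia.
  by rewrite (high_H _ _ p_gt0 yp) (low_T p) //; lia.
have GU : U = fullv.
  apply/eqP; rewrite eqEsubv subvf; apply/subvP => g _.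
  have : g \in (A + (U :&: C))%VS by rewrite GA memvf.
  case/memv_addP => a aA [u /memv_capP[uU _] ->].
  have : a \in ((U :&: A) + C)%VS by rewrite GC memvf.
  case/memv_addP => u' /memv_capP[u'U u'A] [c cC aE].
  suff c0 : c = 0 by rewrite aE c0 addr0 memvD.
  apply: (@nat_eigenspace_disjoint _ _ DG (N + N)
            (fun k => k < N)%N (fun k => N <= k)%N) => //.
    by move=> i; rewrite -ltnNge.
  have -> : c = a - u' by rewrite aE addrC addKr.
  by rewrite memvB.
have H_lt : (\dim H < \dim {:V})%N.
  rewrite ltnNge; apply: contra v_neq0 => dH.
  have HV : H = fullv by apply/eqP; rewrite eqEdim subvf.
  apply/eqP; apply: (@nat_eigenspace_sum_cap _ _ D N (fun m => 0 < m)%N 0).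
  - by move=> i; rewrite lt0n.
  - by rewrite -/H HV memvf.
  - exact: v_eigen.
have HT_lt : (\dim (H :&: T) < \dim H)%N.
  rewrite ltnNge; apply: contra eta_neq0 => dHT.
  have /capv_idPl/subvP HT : (H :&: T)%VS = H.
    by apply/eqP; rewrite eqEdim capvSl.
  apply/eqP/lfunP => x; rewrite zero_lfunE; apply/eqP; rewrite -memv_ker.
  have /memv_sumP[y Vy ->] : x \in (\sum_(m < N) Vm m)%VS by rewrite V_sum memvf.
  apply: memv_suml => m _; have [mM|Mm] := ltnP m M.
    by apply: (low_T m) => //; exact: Vy.
  by apply: HT; apply: (high_H m); rewrite ?Vy // (leq_trans M_neq0).
rewrite -GU (leq_trans (dim_alt_span B_linear_l B_linear_r B_alt _)) //.
by apply: leq_bin2l; lia.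
Qed.

End GradedGeneration.

(** * Spans in spaces of arbitrary dimension *)

Section LinearSpan.
Variables (K : fieldType) (L : lmodType K).

Record subspace (P : L -> Prop) : Prop := Subspace {
  subspace0 : P 0;
  subspaceP : forall (a : K) x y, P x -> P y -> P (a *: x + y)
}.

(** The intersection of all subspaces containing S; this form is its induction
    principle. *)
Definition lin_span (S : L -> Prop) (x : L) : Prop :=
  forall P, subspace P -> (forall y, S y -> P y) -> P x.

Lemma subspaceD P x y : subspace P -> P x -> P y -> P (x + y).
Proof. by move=> sP Px Py; rewrite -[x]scale1r; exact: subspaceP. Qed.

Lemma subspaceZ P a x : subspace P -> P x -> P (a *: x).
Proof.
by move=> sP Px; rewrite -[_ *: _]addr0; apply: subspaceP => //; exact: subspace0.
Qed.

Lemma subspaceN P x : subspace P -> P x -> P (- x).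
Proof. by move=> sP Px; rewrite -scaleN1r; exact: subspaceZ. Qed.

Lemma subspace_sum P (J : Type) (s : seq J) (Q : pred J) (F : J -> L) :
  subspace P -> (forall j, Q j -> P (F j)) -> P (\sum_(j <- s | Q j) F j).
Proof.
move=> sP PF; apply: big_ind => //; first exact: subspace0.
by move=> x y; exact: subspaceD.
Qed.

Lemma lin_span_subspace S : subspace (lin_span S).
Proof.
split=> [P sP _|a x y Sx Sy P sP SP]; first exact: subspace0.
by apply: subspaceP => //; [exact: Sx | exact: Sy].
Qed.

Lemma mem_lin_span (S : L -> Prop) x : S x -> lin_span S x.
Proof. by move=> Sx P _; apply. Qed.

Lemma lin_span_sub (S S' : L -> Prop) x :
  (forall y, S y -> lin_span S' y) -> lin_span S x -> lin_span S' x.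
Proof. by move=> SS'; apply; first exact: lin_span_subspace. Qed.

(** An eigenvector in the span of eigenvectors is in the span of those with the
    same eigenvalue: the remaining part is an eigenvector for la and a sum of
    eigenvectors for other eigenvalues. *)
Lemma lin_span_eigen (T : {linear L -> L}) (S : L -> Prop) la x :
  (forall y, S y -> exists mu, T y = mu *: y) ->
  lin_span S x -> T x = la *: x ->
  lin_span (fun y => S y /\ T y = la *: y) x.
Proof.
move=> Seig Sx Tx; set S' := fun y => _.
pose P (p : L * K) := `[< T p.1 = p.2 *: p.1 >] && (p.2 != la).
pose Q z := exists2 y, lin_span S' y
  & exists s : seq (L * K), z = y + \sum_(p <- s | P p) p.1.
have sS' := lin_span_subspace S'.
have : Q x.
  apply: (Sx Q).
    split.
      exists 0; first exact: (subspace0 sS').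
      by exists [::]; rewrite big_nil addr0.
    move=> a _ _ [y1 S1 [s1 ->]] [y2 S2 [s2 ->]].
    exists (a *: y1 + y2); first exact: (subspaceP sS').
    exists ([seq (a *: p.1, p.2) | p <- s1 & P p] ++ s2).
    rewrite big_cat /= big_map big_filter_cond scalerDr addrACA; congr (_ + (_ + _)).
    rewrite scaler_sumr; apply: eq_bigl => p.
    rewrite /P /=; case: asboolP => //= Tp; case: (_ != _); rewrite ?andbF //= andbT.
    by apply/esym/asboolP; rewrite linearZ /= Tp !scalerA mulrC.
  move=> y Sy; have [mu Ty] := Seig y Sy.
  have [muE|mu_neq] := eqVneq mu la.
    exists y; first by apply: mem_lin_span; split=> //; rewrite -muE.
    by exists [::]; rewrite big_nil addr0.
  exists 0; first exact: (subspace0 sS').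
  exists [:: (y, mu)]; rewrite big_cons big_nil addr0 add0r /P /= mu_neq andbT.
  by case: asboolP.
case=> y S'y [s xE].
suff z0 : \sum_(p <- s | P p) p.1 = 0 by rewrite xE z0 addr0.
apply: (eigen_sum_eq0 _ _ _ (erefl _) (T := T) (mu := fun p => p.2) (la := la)).
- by move=> p /andP[/asboolP].
- by move=> p /andP[].
have Ty : T y = la *: y.
  apply: (S'y (fun y => T y = la *: y)) => [|z []//]; split.
    by rewrite linear0 scaler0.
  by move=> a u w Tu Tw; rewrite linearP Tu Tw scalerDr !scalerA mulrC.
have -> : \sum_(p <- s | P p) p.1 = x - y by rewrite xE addrC addKr.
by rewrite linearB /= Tx Ty scalerBr.
Qed.

Lemma has_dim_span_seq (s : seq L) :
  exists d, has_dim (lin_span (fun y => y \in s)) d.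
Proof.
elim: s => [|x s [d [b [bS b_free b_gen]]]].
  exists 0%N, (fun=> 0); split=> [[]|c _ []|y Sy] //.
  exists (fun=> 0); rewrite big_ord0.
  by apply: (Sy (fun y => y = 0)) => //; split=> // a u w -> ->; rewrite scaler0 addr0.
have sub_cons y : lin_span (fun y => y \in s) y -> lin_span (fun y => y \in x :: s) y.
  by apply: lin_span_sub => z zs; apply: mem_lin_span; rewrite in_cons zs orbT.
have [xS|xnS] := pselect (lin_span (fun y => y \in s) x).
  exists d, b; split=> // [i|y Sy]; first exact: sub_cons.
  apply: b_gen; apply: lin_span_sub Sy => z; rewrite in_cons => /orP[/eqP->//|zs].
  exact: mem_lin_span.
exists d.+1, (fun i => oapp b x (unlift ord0 i)); split.
- move=> i; case: (unliftP ord0 i) => [j|] _ /=; first exact: sub_cons.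
  by apply: mem_lin_span; rewrite mem_head.
- move=> c; rewrite big_ord_recl unlift_none /=.
  under eq_bigr do rewrite liftK /=.
  move=> c0; have c00 : c ord0 = 0.
    apply/eqP; apply: contra_notT xnS => c_neq0.
    have sS := lin_span_subspace (fun y => y \in s).
    have -> : x = - (c ord0)^-1 *: \sum_(i < d) c (lift ord0 i) *: b i.
      apply: (scalerI c_neq0); rewrite scalerA mulrN divff // scaleN1r.
      by apply/eqP; rewrite -addr_eq0 c0.
    apply: (subspaceZ (P := lin_span _)) => //.
    apply: (subspace_sum (P := lin_span _)) => // i _.
    exact: (subspaceZ (P := lin_span _)).
  move: c0; rewrite c00 scale0r add0r => /b_free c0 i.
  by case: (unliftP ord0 i) => [j|] ->.
move=> y Sy; pose P y := exists c : 'I_d.+1 -> K,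
  y = \sum_(i < d.+1) c i *: oapp b x (unlift ord0 i).
apply: (Sy P) => [|z]; first split.
- by exists (fun=> 0); rewrite big1 // => i _; rewrite scale0r.
- move=> a u w [cu ->] [cw ->]; exists (fun i => a * cu i + cw i).
  rewrite scaler_sumr -big_split; apply: eq_bigr => i _ /=.
  by rewrite scalerA -scalerDl.
rewrite in_cons => /orP[/eqP->|zs].
  exists (fun i => (i == ord0)%:R); rewrite big_ord_recl unlift_none eqxx scale1r /=.
  by rewrite big1 ?addr0 // => i _; rewrite scale0r.
have /b_gen[c ->] : lin_span (fun y => y \in s) z by exact: mem_lin_span.
exists (fun i => oapp c 0 (unlift ord0 i)).
rewrite big_ord_recl unlift_none /= scale0r add0r.
by apply: eq_bigr => i _; rewrite liftK.
Qed.

Lemma has_dim_coordinates (U : L -> Prop) d : subspace U -> has_dim U d ->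
  exists iota : 'rV[K]_d -> L, [/\ linear iota, injective iota
    & forall x, U x <-> exists c, x = iota c].
Proof.
move=> sU [b [bU b_free b_gen]].
pose iota (c : 'rV[K]_d) := \sum_(i < d) c 0 i *: b i.
have lin_iota : linear iota.
  move=> a c c'; rewrite /iota scaler_sumr -big_split; apply: eq_bigr => i _ /=.
  by rewrite !mxE scalerDl scalerA.
exists iota; split=> // [c c' eq_c|x].
  apply/subr0_eq/rowP => i; rewrite [RHS]mxE; apply: (b_free ((c - c') 0)).
  have := lin_iota (-1) c' c; rewrite eq_c !scaleN1r addNr addrC; exact.
split=> [/b_gen[c ->]|[c ->]].
  by exists (\row_i c i); apply: eq_bigr => i _; rewrite mxE.
by apply: subspace_sum => // i _; exact: subspaceZ.
Qed.

End LinearSpan.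

(** * Brackets of a subspace generated by one vector *)

Section LieBasics.
Variables (K : fieldType) (L : lieAlgType K).
Implicit Types x y z : L.

Lemma bracketDl x y z : bracket (x + y) z = bracket x z + bracket y z.
Proof. by rewrite -[x]scale1r bracketPl !scale1r. Qed.
Lemma bracketDr x y z : bracket z (x + y) = bracket z x + bracket z y.
Proof. by rewrite -[x]scale1r bracketPr !scale1r. Qed.
Lemma bracket0l z : bracket (0 : L) z = 0.
Proof. by apply: (@addIr _ (bracket 0 z)); rewrite -bracketDl !add0r. Qed.
Lemma bracket0r z : bracket z (0 : L) = 0.
Proof. by apply: (@addIr _ (bracket z 0)); rewrite -bracketDr !add0r. Qed.
Lemma bracketZl a x z : bracket (a *: x) z = a *: bracket x z.
Proof. by rewrite -[a *: x]addr0 bracketPl bracket0l addr0. Qed.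
Lemma bracketZr a x z : bracket z (a *: x) = a *: bracket z x.
Proof. by rewrite -[a *: x]addr0 bracketPr bracket0r addr0. Qed.
Lemma bracketNr x z : bracket z (- x) = - bracket z x.
Proof. by rewrite -scaleN1r bracketZr scaleN1r. Qed.

Lemma bracket_linear_r x : linear (bracket x).
Proof. by move=> a y z; rewrite bracketPr. Qed.

Definition ad x : {linear L -> L} :=
  HB.pack (bracket x)
    (GRing.isLinear.Build K L L *:%R (bracket x) (bracket_linear_r x)).

Lemma adE x y : ad x y = bracket x y. Proof. by []. Qed.

Lemma bracket_derivation x y z :
  bracket x (bracket y z) = bracket (bracket x y) z + bracket y (bracket x z).
Proof.
have := jacobi x y z.
rewrite (bracketC z x) bracketNr (bracketC z (bracket x y)).
by move/eqP; rewrite -addrA -opprD subr_eq0 => /eqP->; exact: addrC.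
Qed.

Lemma bracket_preimage (P : L -> Prop) x :
  subspace P -> subspace (fun y => P (bracket x y)).
Proof.
move=> sP; split; first by rewrite bracket0r; exact: subspace0.
by move=> a y z Py Pz; rewrite bracketPr; exact: subspaceP.
Qed.

Section OrbitSpan.
Variables (I : Type) (e : I -> L) (v : L).

Definition orbit_span (x : L) : Prop := forall P : L -> Prop,
  subspace P -> P v -> (forall i x, P x -> P (bracket (e i) x)) -> P x.

Lemma orbit_span_subspace : subspace orbit_span.
Proof.
split=> [P sP _ _|a x y Jx Jy P sP Pv Pe]; first exact: subspace0.
by apply: subspaceP; [|exact: Jx|exact: Jy].
Qed.

Lemma mem_orbit_span : orbit_span v. Proof. by move=> P. Qed.

Lemma orbit_span_step i x : orbit_span x -> orbit_span (bracket (e i) x).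
Proof. by move=> Jx P sP Pv Pe; apply: (Pe); exact: Jx. Qed.

(** The induction step may use that x is in the orbit span itself. *)
Lemma orbit_span_ind (P : L -> Prop) : subspace P -> P v ->
  (forall i x, orbit_span x -> P x -> P (bracket (e i) x)) ->
  forall x, orbit_span x -> P x.
Proof.
move=> sP Pv Pe x Jx; have sJ := orbit_span_subspace.
suff [] : orbit_span x /\ P x by [].
apply: (Jx (fun x => orbit_span x /\ P x)) => [||i y [Jy Py]].
- split=> [|a y z [Jy Py] [Jz Pz]].
    by split; [exact: (subspace0 sJ) | exact: subspace0].
  by split; [exact: (subspaceP sJ) | exact: subspaceP].
- by split; first exact: mem_orbit_span.
- by split; [exact: orbit_span_step | exact: Pe].
Qed.

End OrbitSpan.

Definition bracket_of (U : L -> Prop) (z : L) : Prop :=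
  exists x y, [/\ U x, U y & z = bracket x y].

End LieBasics.


Lemma lift_hom (K : fieldType) (L : lmodType K) (U W : vectType K)
    (iota : U -> L) (kappa : W -> L) (g : L -> L) :
  linear iota -> linear kappa -> injective kappa -> linear g ->
  (forall u, exists w, g (iota u) = kappa w) ->
  exists phi : 'Hom(U, W), forall u, kappa (phi u) = g (iota u).
Proof.
move=> li lk ik lg /choice[phi phiE].
have [|psi psiE] := @linear_hom K U W phi.
  by move=> a x y; apply: ik; rewrite -phiE li lg !phiE lk.
by exists psi => u; rewrite psiE phiE.
Qed.

(** The height grading of U is given by ad rho.  The span of the brackets of U
    is finite-dimensional, being spanned by the brackets of a basis, so that
    [dim_graded_image] applies after a choice of coordinates. *)
Theorem dim_brackets (K : numFieldType) (L : lieAlgType K) (I : finType)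
    (e : I -> L) (v rho : L) (U := orbit_span e v) (d : nat) :
  (forall i, bracket rho (e i) = e i) -> bracket rho v = 0 ->
  (forall i, bracket v (bracket (e i) v) = 0) -> has_dim U d ->
  exists2 d2, has_dim (lin_span (bracket_of U)) d2 & (d2 <= 'C(d.-2, 2))%N.
Proof.
move=> he hv serre dimU; set G := lin_span (bracket_of U).
have sU : subspace U := orbit_span_subspace e v.
have sG : subspace G := lin_span_subspace _.
have [d2 dimG] : exists d2, has_dim G d2.
  have [b [bU _ b_gen]] := dimU.
  pose s := [seq bracket (b i) (b j) | i <- enum 'I_d, j <- enum 'I_d].
  have [d2 dim2] := has_dim_span_seq s.
  exists d2; suff <- : lin_span (fun y : L => y \in s) = G by [].
  apply/funext => x; apply/propext; split; apply: lin_span_sub => y.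
    case/allpairsP => -[i j] /= [_ _ ->]; apply: mem_lin_span.
    by exists (b i), (b j).
  case=> x1 [x2 [/b_gen[c ->] /b_gen[c' ->] ->]].
  set S := lin_span _; have sS : subspace S := lin_span_subspace _.
  rewrite -adE linear_sum; apply: (subspace_sum _ sS) => j _.
  rewrite linearZ; apply: (subspaceZ _ sS) => /=; rewrite bracketC -adE linear_sum.
  apply: (subspaceN sS); apply: (subspace_sum _ sS) => i _.
  rewrite linearZ; apply: (subspaceZ _ sS) => /=; rewrite bracketC.
  apply: (subspaceN sS); apply: mem_lin_span; apply/allpairsP.
  by exists (i, j); rewrite !mem_enum.
exists d2 => //.
have [iV [liV iV_inj iV_im]] := has_dim_coordinates sU dimU.
have [iG [liG iG_inj iG_im]] := has_dim_coordinates sG dimG.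
have iV_U c : U (iV c) by apply/iV_im; exists c.
have [v0 v0E] : exists v0, v = iV v0 by apply/iV_im; exact: mem_orbit_span.
have brG x y : U x -> U y -> G (bracket x y).
  by move=> Ux Uy; apply: mem_lin_span; exists x, y.
have Ue i x : U x -> U (bracket (e i) x) by exact: orbit_span_step.
have Uh x : U x -> U (bracket rho x).
  apply: (orbit_span_ind (P := fun x => U (bracket rho x))) => [||i y Uy Uhy].
  - exact: bracket_preimage.
  - by rewrite hv; exact: (subspace0 sU).
  - by rewrite bracket_derivation he; apply: (subspaceD sU); exact: Ue.
have stableG g : (forall x, U x -> U (bracket g x)) -> forall x, G x -> G (bracket g x).
  move=> Ug x Gx; apply: (Gx (fun x => G (bracket g x))).
    exact: bracket_preimage.
  move=> _ [y [z [Uy Uz ->]]]; rewrite bracket_derivation.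
  by apply: (subspaceD sG); apply: brG => //; exact: Ug.
have /choice[B0 B0E] : forall p : 'rV[K]_d * 'rV[K]_d,
    exists w, bracket (iV p.1) (iV p.2) = iG w.
  by move=> p; apply/iG_im; exact: brG.
pose B x y := B0 (x, y).
have BE x y : iG (B x y) = bracket (iV x) (iV y) by rewrite -(B0E (x, y)).
have liftV g : (forall x, U x -> U (bracket g x)) ->
    exists phi : 'End('rV[K]_d), forall u, iV (phi u) = bracket g (iV u).
  move=> Ug; apply: lift_hom => //; first exact: bracket_linear_r.
  by move=> u; apply/iV_im; exact: Ug.
have liftG g : (forall x, U x -> U (bracket g x)) ->
    exists phi : 'End('rV[K]_d2), forall u, iG (phi u) = bracket g (iG u).
  move=> Ug; apply: lift_hom => //; first exact: bracket_linear_r.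
  by move=> u; apply/iG_im; apply: stableG => //; apply/iG_im; exists u.
have [E EE] := choice (fun i => liftV (e i) (Ue i)).
have [F FE] := choice (fun i => liftG (e i) (Ue i)).
have [D DE] := liftV rho Uh; have [DG DGE] := liftG rho Uh.
have iG_D x y : iG (x + y) = iG x + iG y by rewrite -[x]scale1r liG !scale1r.
have iV_D x y : iV (x + y) = iV x + iV y by rewrite -[x]scale1r liV !scale1r.
have iG0 : iG 0 = 0 by apply: (@addIr _ (iG 0)); rewrite -iG_D !add0r.
have iV0 : iV 0 = 0 by apply: (@addIr _ (iV 0)); rewrite -iV_D !add0r.
have Bl y : linear (B^~ y).
  by move=> a x x'; apply: iG_inj; rewrite liG !BE liV bracketPl.
have Br x : linear (B x).
  by move=> a y y'; apply: iG_inj; rewrite liG !BE liV bracketPr.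
have dim_rV m : \dim {: 'rV[K]_m} = m by rewrite dimvf dim_matrix; exact: mul1n.
have Balt x : B x x = 0 by apply: iG_inj; rewrite BE bracketxx iG0.
have := @dim_graded_image K 'rV[K]_d 'rV[K]_d2 B Bl Br Balt I E F D DG v0.
rewrite !dim_rV; apply.
- by move=> i x y; apply: iG_inj; rewrite FE iG_D !BE bracket_derivation !EE.
- by move=> x y; apply: iG_inj; rewrite DGE iG_D !BE bracket_derivation !DE.
- move=> i x; apply: iV_inj; rewrite DE iV_D !EE bracket_derivation he DE.
  by [].
- by apply: iV_inj; rewrite DE -v0E hv iV0.
- by move=> i; apply: iG_inj; rewrite BE EE -v0E serre iG0.
- move=> X v0X EX; apply/eqP; rewrite eqEsubv subvf; apply/subvP => c _.
  have [c' c'X /iV_inj->//] : exists2 c', c' \in X & iV c = iV c'.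
  apply: (iV_U c (fun x => exists2 c', c' \in X & x = iV c')).
  + split=> [|a _ _ [x xX ->] [y yX ->]]; first by exists 0; rewrite ?mem0v.
    by exists (a *: x + y); rewrite ?liV // memvD ?memvZ.
  + by exists v0.
  + by move=> i _ [x xX ->]; exists (E i x); [exact: EX | rewrite EE].
apply/eqP; rewrite eqEsubv subvf; apply/subvP => c _.
have Gc : G (iG c) by apply/iG_im; exists c.
have [c' c'X /iG_inj->//] : exists2 c', c' \in alt_span B fullv & iG c = iG c'.
apply: (Gc (fun x => exists2 c', c' \in alt_span B fullv & x = iG c')).
  split=> [|a _ _ [x xX ->] [y yX ->]]; first by exists 0; rewrite ?mem0v.
  by exists (a *: x + y); rewrite ?liG // memvD ?memvZ.
move=> _ [_ [_ [/iV_im[x ->] /iV_im[y ->] ->]]].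
exists (B x y); last by rewrite BE.
by apply: mem_alt_span => //; exact: memvf.
Qed.
(** * Lie algebras with Chevalley generators *)

Section Words.
Variables (K : numFieldType) (L : lieAlgType K) (C : lmodType K) (n : nat).
Variables (h : C -> L) (e f : 'I_n -> L) (alpha : 'I_n -> C -> K) (alphav : 'I_n -> C).
Hypothesis br_hf : forall t i, bracket (h t) (f i) = - alpha i t *: f i.
Hypothesis br_ef : forall i j, bracket (e i) (f j) = if i == j then h (alphav i) else 0.

Definition word (g : 'I_n -> L) (w : seq 'I_n) (i : 'I_n) : L :=
  foldr (fun j x => bracket (g j) x) (g i) w.

Definition is_word (g : 'I_n -> L) (x : L) : Prop := exists i w, x = word g w i.
Definition is_cartan (x : L) : Prop := exists t, x = h t.

Lemma weight_word (g : 'I_n -> L) (be : 'I_n -> C -> K) t :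
  (forall i, bracket (h t) (g i) = be i t *: g i) ->
  forall w i, bracket (h t) (word g w i) = (\sum_(j <- i :: w) be j t) *: word g w i.
Proof.
move=> hg; elim=> [|j w IHw] i; first by rewrite big_seq1 hg.
rewrite /= bracket_derivation hg IHw bracketZl bracketZr -scalerDl.
by congr (_ *: _); rewrite !big_cons addrCA.
Qed.

(** Stated for generators e and f that play asymmetric roles, so that it also
    applies with e and f exchanged and the roots negated. *)
Lemma bracket_e_word_f j x : is_word f x ->
  lin_span (fun y => is_cartan y \/ is_word f y) (bracket (e j) x).
Proof.
set S := fun y => _; have sS := lin_span_subspace S.
case=> i [w ->]; elim: w => [|k w IHw] /=.
  rewrite br_ef; case: eqP => _; last exact: subspace0.
  by apply: mem_lin_span; left; exists (alphav j).
rewrite bracket_derivation br_ef; apply: (subspaceD sS).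
  case: eqP => _; last by rewrite bracket0l; exact: subspace0.
  rewrite (@weight_word _ (fun i t => - alpha i t)) //.
  apply: (subspaceZ _ sS); apply: mem_lin_span; right; by exists i, w.
pose P y := lin_span S (bracket (f k) y).
apply: (IHw P); first exact: bracket_preimage.
move=> y [[t ->]|[i' [w' ->]]].
  rewrite /P bracketC br_hf scaleNr opprK; apply: (subspaceZ _ sS).
  by apply: mem_lin_span; right; exists k, [::].
by apply: mem_lin_span; right; exists i', (k :: w').
Qed.

End Words.

Section Contragredient.
Variables (K : numFieldType) (L : lieAlgType K) (C : lmodType K) (n : nat).
Variables (h : C -> L) (e f : 'I_n -> L) (alpha : 'I_n -> C -> K) (alphav : 'I_n -> C).
Hypothesis h_linear : linear h.
Hypothesis br_hh : forall s t, bracket (h s) (h t) = 0.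
Hypothesis br_he : forall t i, bracket (h t) (e i) = alpha i t *: e i.
Hypothesis br_hf : forall t i, bracket (h t) (f i) = - alpha i t *: f i.
Hypothesis br_ef : forall i j, bracket (e i) (f j) = if i == j then h (alphav i) else 0.
Hypothesis generated : forall P : L -> Prop, subspace P ->
  (forall x y, P x -> P y -> P (bracket x y)) ->
  (forall t, P (h t)) -> (forall i, P (e i)) -> (forall i, P (f i)) ->
  forall x, P x.

Let S x := [\/ is_cartan h x, is_word e x | is_word f x].

Lemma bracket_fe i j : bracket (f i) (e j) = if i == j then h (- alphav i) else 0.
Proof.
have hN t : h (- t) = - h t.
  have := h_linear (-1) t 0; have := h_linear (-1) 0 0.
  by rewrite scaler0 !addr0 !scaleN1r addNr => -> ->; rewrite addr0.
by rewrite bracketC br_ef eq_sym; case: eqP => [->|_]; rewrite ?hN ?oppr0.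
Qed.

Lemma lie_normalizer (P : L -> Prop) : subspace P ->
  (forall t y, P y -> P (bracket (h t) y)) ->
  (forall i y, P y -> P (bracket (e i) y)) ->
  (forall i y, P y -> P (bracket (f i) y)) ->
  forall x y, P y -> P (bracket x y).
Proof.
move=> sP Ph Pe Pf x.
apply: (generated (P := fun x => forall y, P y -> P (bracket x y))) x => //.
  split=> [y _|a x x' Px Px' y Py]; first by rewrite bracket0l; exact: subspace0.
  by rewrite bracketPl; apply: subspaceP; [|exact: Px|exact: Px'].
move=> x x' Px Px' y Py.
have -> : bracket (bracket x x') y
        = bracket x (bracket x' y) - bracket x' (bracket x y).
  by rewrite (bracket_derivation x) addrK.
by apply: (subspaceD sP); [|apply: (subspaceN sP)]; [apply/Px/Px' | apply/Px'/Px].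
Qed.

(** The span of h and of the words in the e_i and in the f_i contains the
    generators and is stable under bracketing with them. *)
Lemma triangular_decomposition x : lin_span S x.
Proof.
have sS := lin_span_subspace S.
have in_S y : S y -> lin_span S y by exact: mem_lin_span.
have stable g : (forall y, S y -> lin_span S (bracket g y)) ->
    forall y, lin_span S y -> lin_span S (bracket g y).
  move=> gS y Sy; pose P y := lin_span S (bracket g y).
  by apply: (Sy P) => //; exact: bracket_preimage.
have closed : forall x y, lin_span S y -> lin_span S (bracket x y).
  apply: lie_normalizer => // [t|i|i]; apply: stable => y.
  - case=> [[s ->]|[i [w ->]]|[i [w ->]]].
    + by rewrite br_hh; exact: (subspace0 sS).
    + rewrite (weight_word (be := alpha)) //; apply: (subspaceZ _ sS).
      by apply: in_S; apply: Or32; exists i, w.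
    + rewrite (weight_word (be := fun i t => - alpha i t)) //; apply: (subspaceZ _ sS).
      by apply: in_S; apply: Or33; exists i, w.
  - case=> [[s ->]|[j [w ->]]|fy].
    + rewrite bracketC br_he -scaleNr; apply: (subspaceZ _ sS).
      by apply: in_S; apply: Or32; exists i, [::].
    + by apply: in_S; apply: Or32; exists j, (i :: w).
    + apply: lin_span_sub (bracket_e_word_f br_hf br_ef i fy) => z [zh|zf].
        by apply: in_S; exact: Or31.
      by apply: in_S; exact: Or33.
  - case=> [[s ->]|ey|[j [w ->]]].
    + rewrite bracketC br_hf -scaleNr; apply: (subspaceZ _ sS).
      by apply: in_S; apply: Or33; exists i, [::].
    + have br_he' t j : bracket (h t) (e j) = - (- alpha j t) *: e j.
        by rewrite opprK.
      have := bracket_e_word_f (alpha := fun i t => - alpha i t)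
                br_he' bracket_fe i ey.
      apply: lin_span_sub => z [zh|zf].
        by apply: in_S; exact: Or31.
      by apply: in_S; exact: Or32.
    + by apply: in_S; apply: Or33; exists j, (i :: w).
move: x; apply: generated => //.
- by move=> x y _; exact: closed.
- by move=> t; apply: in_S; apply: Or31; exists t.
- by move=> i; apply: in_S; apply: Or32; exists i, [::].
- by move=> i; apply: in_S; apply: Or33; exists i, [::].
Qed.

(** The bracket with h (dual a) multiplies a word by the number of its letters
    a, counted negatively for the f_i: it defines the grading of the node a. *)
Variable dual : 'I_n -> C.
Hypothesis alpha_dual : forall i j, alpha i (dual j) = (i == j)%:R.
Hypothesis alpha_additive : forall i, {morph alpha i : s t / s + t}.

Lemma alpha0 i : alpha i 0 = 0.
Proof. by apply: (@addIr _ (alpha i 0)); rewrite -alpha_additive !add0r. Qed.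

Lemma alphaN i t : alpha i (- t) = - alpha i t.
Proof. by apply: (@addIr _ (alpha i t)); rewrite -alpha_additive !addNr alpha0. Qed.

Definition degree_word (a : 'I_n) (k : nat) (x : L) : Prop :=
  exists i w, x = word e w i /\ count_mem a (i :: w) = k.

Lemma dual_weight_e a w i :
  bracket (h (dual a)) (word e w i) = (count_mem a (i :: w))%:R *: word e w i.
Proof.
rewrite (weight_word (be := alpha)) //; congr (_ *: _).
rewrite -sum1_count natr_sum [RHS]big_mkcond; apply: eq_bigr => j _.
by rewrite alpha_dual /=; case: eqP.
Qed.

Lemma dual_weight_f a w i :
  bracket (h (dual a)) (word f w i) = - (count_mem a (i :: w))%:R *: word f w i.
Proof.
rewrite (weight_word (be := fun i t => - alpha i t)) //; congr (_ *: _).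
rewrite sumrN -sum1_count natr_sum; congr (- _); rewrite [RHS]big_mkcond.
by apply: eq_bigr => j _; rewrite alpha_dual /=; case: eqP.
Qed.

(** For k > 0 the eigenvalue k occurs only on words in the e_i, as h has
    eigenvalue 0 and words in the f_i have eigenvalues <= 0. *)
Lemma degree_word_eigen a k x : (0 < k)%N ->
  bracket (h (dual a)) x = k%:R *: x -> lin_span (degree_word a k) x.
Proof.
move=> k_gt0 xk.
have : lin_span (fun y => S y /\ ad (h (dual a)) y = k%:R *: y) x.
  apply: lin_span_eigen => //; last exact: triangular_decomposition.
  move=> y [[t ->]|[i [w ->]]|[i [w ->]]].
  - by exists 0; rewrite adE br_hh scale0r.
  - by eexists; rewrite adE dual_weight_e.
  - by eexists; rewrite adE dual_weight_f.
have s0 := subspace0 (lin_span_subspace (degree_word a k)).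
apply: lin_span_sub => y [[[t ->]|[i [w ->]]|[i [w ->]]]]; rewrite adE.
- rewrite br_hh => /esym/eqP; rewrite scaler_eq0 pnatr_eq0 -leqn0 leqNgt k_gt0 /=.
  by move=> /eqP->.
- rewrite dual_weight_e => /eqP.
  rewrite -subr_eq0 -scalerBl scaler_eq0 subr_eq0 eqr_nat.
  case/orP => /eqP ck; last by rewrite ck.
  by apply: mem_lin_span; exists i, w.
- rewrite dual_weight_f => /eqP; rewrite -subr_eq0 -scalerBl scaler_eq0.
  rewrite -opprD oppr_eq0 -natrD pnatr_eq0 addn_eq0.
  rewrite -[k == 0]leqn0 leqNgt k_gt0 andbF /=.
  by move=> /eqP->.
Qed.

(** This is what the maximality of the radical amounts to in the quotient. *)
Hypothesis no_ideal : forall J : L -> Prop, subspace J ->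
  (forall x y, J y -> J (bracket x y)) ->
  (forall t, J (h t) -> h t = 0) -> forall x, J x -> x = 0.

(** Take rho with alpha i rho = 1 for all i: ad rho multiplies a word by its
    length, which is positive, and it kills h. *)
Lemma word_cartan_eq0 t : lin_span (is_word e) (h t) -> h t = 0.
Proof.
pose rho := \sum_j dual j.
have alpha_rho i : alpha i rho = 1.
  rewrite (big_morph (alpha i) (alpha_additive i) (alpha0 i)).
  rewrite (bigD1 i) //= alpha_dual eqxx.
  by rewrite big1 ?addr0 // => j ji; rewrite alpha_dual eq_sym (negPf ji).
have rho_word w i : ad (h rho) (word e w i) = (size (i :: w))%:R *: word e w i.
  rewrite adE (weight_word (be := alpha)) //; congr (_ *: _).
  by rewrite -sum1_size natr_sum; apply: eq_bigr => j _; rewrite alpha_rho.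
move=> ht; have : lin_span (fun y => is_word e y /\ ad (h rho) y = 0 *: y) (h t).
  apply: lin_span_eigen => //; last by rewrite adE br_hh scale0r.
  by move=> _ [i [w ->]]; eexists; exact: rho_word.
move/(_ (fun y => y = 0)); apply=> [|_ [[i [w ->]]]].
  by split=> // a u v -> ->; rewrite scaler0 addr0.
by rewrite rho_word scale0r => /eqP; rewrite scaler_eq0 pnatr_eq0 => /eqP.
Qed.

(** The subspace generated by y under the ad e_i is stable under h, and also
    under the f_j, because [f_j, e_i] is in h and f_j kills y.  So it is an
    ideal, and it consists of words in the e_i. *)
Lemma singular_eq0 y : lin_span (is_word e) y ->
  (exists mu, forall t, bracket (h t) y = mu t *: y) ->
  (forall j, bracket (f j) y = 0) -> y = 0.
Proof.
move=> ye [mu yh] yf.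
pose J := orbit_span e y; have sJ : subspace J := orbit_span_subspace e y.
have Je i x : J x -> J (bracket (e i) x) by exact: orbit_span_step.
have Jh t x : J x -> J (bracket (h t) x).
  apply: (orbit_span_ind (P := fun x => J (bracket (h t) x))) => {x} [||i x Jx Jhx].
  - exact: bracket_preimage.
  - by rewrite yh; apply: (subspaceZ _ sJ); exact: mem_orbit_span.
  - rewrite bracket_derivation br_he bracketZl.
    by apply: (subspaceP sJ); exact: Je.
have Jf j x : J x -> J (bracket (f j) x).
  apply: (orbit_span_ind (P := fun x => J (bracket (f j) x))) => {x} [||i x Jx Jfx].
  - exact: bracket_preimage.
  - by rewrite yf; exact: (subspace0 sJ).
  - rewrite bracket_derivation bracket_fe; apply: (subspaceD sJ); last exact: Je.
    by case: eqP => _; [exact: Jh | rewrite bracket0l; exact: (subspace0 sJ)].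
apply: (no_ideal sJ); [exact: lie_normalizer | | exact: mem_orbit_span].
move=> t Jt; apply: word_cartan_eq0; apply: Jt => //.
  exact: lin_span_subspace.
have sE := lin_span_subspace (is_word e).
move=> j x xe; apply: (xe (fun x => lin_span (is_word e) (bracket (e j) x))).
  exact: bracket_preimage.
by move=> _ [k [u ->]]; apply: mem_lin_span; exists k, (j :: u).
Qed.

(** A word with one letter a is built from e_a: the letters before a act by
    ad e_j, and [e_a, x] = - [x, e_a], where ad x for a word x without the letter
    a is a polynomial in the ad e_j by the Jacobi identity. *)
Lemma degree1_orbit a x : lin_span (degree_word a 1) x <->
  orbit_span (fun j : {j | j != a} => e (val j)) (e a) x.
Proof.
set J := orbit_span _ _; have sJ : subspace J := orbit_span_subspace _ _.
split.
  apply=> // _ [i [w [->]]].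
  have J0 u k y : count_mem a (k :: u) = 0%N -> J y -> J (bracket (word e u k) y).
    elim: u k y => [|j u IHu] k y /= cu Jy.
      have ka : k != a by move: cu; case: (k == a).
      exact: (@orbit_span_step _ _ _ _ _ (exist _ k ka)).
    have ja : j != a by move: cu; case: (j == a); rewrite ?addnS.
    have cu' : count_mem a (k :: u) = 0%N by move: cu => /=; lia.
    have Jej z : J z -> J (bracket (e j) z).
      exact: (@orbit_span_step _ _ _ _ _ (exist _ j ja)).
    have -> : bracket (bracket (e j) (word e u k)) y
        = bracket (e j) (bracket (word e u k) y)
          - bracket (word e u k) (bracket (e j) y).
      by rewrite (bracket_derivation (e j)) addrK.
    apply: (subspaceD sJ); [|apply: (subspaceN sJ)].
      by apply: Jej; exact: IHu.
    by apply: IHu => //; exact: Jej.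
  elim: w i => [|j w IHw] i /= cw.
    have -> : i = a by apply/eqP; move: cw; case: (i == a).
    exact: mem_orbit_span.
  have [ja|ja] := eqVneq j a.
    rewrite ja bracketC; apply: (subspaceN sJ); apply: J0.
      by move: cw; rewrite ja eqxx /=; lia.
    exact: mem_orbit_span.
  have Jej z : J z -> J (bracket (e j) z).
    exact: (@orbit_span_step _ _ _ _ _ (exist _ j ja)).
  by apply: Jej; apply: IHw; move: cw; rewrite (negPf ja) /=; lia.
have sC := lin_span_subspace (degree_word a 1).
apply: (orbit_span_ind (P := lin_span (degree_word a 1))) => //.
  by apply: mem_lin_span; exists a, [::]; rewrite /= eqxx.
move=> [j ja] {}x _ xC.
apply: (xC (fun y => lin_span (degree_word a 1) (bracket (e j) y))).
  exact: bracket_preimage.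
move=> _ [i [w [-> cw]]]; apply: mem_lin_span; exists i, (j :: w); split=> //.
by move: cw => /=; rewrite (negPf ja); lia.
Qed.

(** In a word with two letters a, the outermost a is bracketed with an element
    of degree 1, and the letters j <> a before it act as derivations that
    preserve degree 1. *)
Lemma degree2_brackets a x : lin_span (degree_word a 2) x <->
  lin_span (bracket_of (lin_span (degree_word a 1))) x.
Proof.
set U := lin_span (degree_word a 1); set S2 := lin_span (bracket_of U).
have sU : subspace U := lin_span_subspace _.
have s2 : subspace S2 := lin_span_subspace _.
split; last first.
  apply: lin_span_sub => _ [y [z [Uy Uz ->]]].
  have weight1 u : U u -> bracket (h (dual a)) u = u.
    move=> Uu; apply: (Uu (fun u => bracket (h (dual a)) u = u)).
      split; first by rewrite bracket0r.
      by move=> c s t hs ht; rewrite bracketPr hs ht.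
    by move=> _ [i [w [-> cw]]]; rewrite dual_weight_e cw scale1r.
  apply: degree_word_eigen => //; rewrite bracket_derivation !weight1 //.
  by rewrite scaler_nat mulr2n.
apply=> // _ [i [w [->]]].
elim: w i => [|j w IHw] i /= cw; first by move: cw; case: (i == a).
have [ja|ja] := eqVneq j a.
  rewrite ja; apply: mem_lin_span; exists (e a), (word e w i); split=> //.
    by apply: mem_lin_span; exists a, [::]; rewrite /= eqxx.
  by apply: mem_lin_span; exists i, w; split=> //; move: cw; rewrite ja eqxx /=; lia.
have S2w : S2 (word e w i) by apply: IHw; move: cw; rewrite (negPf ja) /=; lia.
have U_ej y : U y -> U (bracket (e j) y).
  move=> /degree1_orbit Jy; apply/degree1_orbit.
  exact: (@orbit_span_step _ _ _ _ _ (exist _ j ja)).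
apply: (S2w (fun y => S2 (bracket (e j) y))); first exact: bracket_preimage.
move=> _ [y [z [Uy Uz ->]]]; rewrite bracket_derivation.
apply: (subspaceD s2); apply: mem_lin_span.
  by exists (bracket (e j) y), z; split=> //; exact: U_ej.
by exists y, (bracket (e j) z); split=> //; exact: U_ej.
Qed.

(** For j <> a, ad f_j kills [e_a,[e_a,e_i]] since [h, e_a] is a multiple of
    e_a.  For j = a the result is (2 + 2 alpha i (alphav a)) [e_a, e_i] up to
    sign, which vanishes for the value -1.  For the value 0, already [e_a, e_i]
    is killed by all ad f_j. *)
Lemma serre_relation a i : i != a ->
  alpha a (alphav a) = 2 ->
  alpha i (alphav a) = -1 \/ alpha i (alphav a) = 0 /\ alpha a (alphav i) = 0 ->
  bracket (e a) (bracket (e a) (e i)) = 0.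
Proof.
move=> ia alpha_aa alpha_ia.
have word_singular w k : (forall j, bracket (f j) (word e w k) = 0) -> word e w k = 0.
  apply: singular_eq0; first by apply: mem_lin_span; exists k, w.
  by eexists=> t; rewrite (weight_word (be := alpha)).
case: alpha_ia => [alpha_ia|[alpha_ia alpha_ai]].
  apply: (word_singular [:: a; a] i) => j /=.
  rewrite !(bracket_derivation (f j)) !bracket_fe.
  have [ja|ja] := eqVneq j a.
    rewrite ja eq_sym (negPf ia) bracket0r addr0 br_he bracketZr bracket_derivation.
    rewrite !br_he bracketZl bracketZr !alphaN alpha_aa alpha_ia -!scalerDl.
    by rewrite opprK (_ : _ + _ = 0) ?scale0r //; ring.
  rewrite !bracket0l !add0r; case: eqP => _; last by rewrite !bracket0r.
  by rewrite (bracketC (e a) (h _)) br_he bracketNr bracketZr bracketxx scaler0 oppr0.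
suff -> : bracket (e a) (e i) = 0 by rewrite bracket0r.
apply: (word_singular [:: a] i) => j /=.
rewrite (bracket_derivation (f j)) !bracket_fe.
have [ja|ja] := eqVneq j a.
  by rewrite ja eq_sym (negPf ia) bracket0r addr0 br_he alphaN alpha_ia oppr0 scale0r.
rewrite bracket0l add0r; have [->|_] := eqVneq j i; last by rewrite bracket0r.
by rewrite bracketC br_he alphaN alpha_ai oppr0 scale0r oppr0.
Qed.

Theorem dim_degree2 a d : alpha a (alphav a) = 2 ->
  (forall i, i != a ->
     alpha i (alphav a) = -1 \/ alpha i (alphav a) = 0 /\ alpha a (alphav i) = 0) ->
  has_dim (lin_span (degree_word a 1)) d ->
  exists2 d2, has_dim (lin_span (degree_word a 2)) d2 & (d2 <= 'C(d.-2, 2))%N.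
Proof.
move=> alpha_aa alpha_ia.
have -> : lin_span (degree_word a 2)
        = lin_span (bracket_of (lin_span (degree_word a 1))).
  by apply/funext => x; apply/propext; exact: degree2_brackets.
have -> : lin_span (degree_word a 1)
        = orbit_span (fun j : {j | j != a} => e (val j)) (e a).
  by apply/funext => x; apply/propext; exact: degree1_orbit.
pose rho := \sum_(j | j != a) dual j.
have alpha_rho i : alpha i rho = (i != a)%:R.
  rewrite (big_morph (alpha i) (alpha_additive i) (alpha0 i)).
  have [->|ia] := eqVneq i a.
    by rewrite big1 // => j ja; rewrite alpha_dual eq_sym (negPf ja).
  rewrite (bigD1 i) //= alpha_dual eqxx big1 ?addr0 // => j /andP[_ ji].
  by rewrite alpha_dual eq_sym (negPf ji).
apply: (@dim_brackets _ _ _ _ _ (h rho)).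
- by move=> [i ia] /=; rewrite br_he alpha_rho ia scale1r.
- by rewrite br_he alpha_rho eqxx scale0r.
- move=> [i ia] /=; rewrite (bracketC (e i)) bracketNr serre_relation ?oppr0 //.
  exact: alpha_ia.
Qed.

End Contragredient.

(** * The grading of a Kac-Moody algebra by a node *)

Section KacMoodyGrading.
Variables (K : numFieldType) (n : nat) (A : 'M[int]_n) (rz : realization K A).
Variable r : lie_ideal (km_tilde rz).
Hypothesis r_rad : km_radical r.

Local Notation g := (kac_moody r).

Definition km_e (i : 'I_n) : g :=
  lie_proj r (lie_gen (@km_rel K n A rz) (@EGen K n A rz i)).
Definition km_f (i : 'I_n) : g :=
  lie_proj r (lie_gen (@km_rel K n A rz) (@FGen K n A rz i)).

Let pr (x : lie_term K (km_gen rz)) : g :=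
  lie_proj r (\pi_(presented_lie (@km_rel K n A rz))%qT x).

Lemma pr_rel x y : km_rel x y -> pr x = pr y.
Proof.
by move=> xy; congr (lie_proj r _); apply/presented_eqP; exact: cong_rel.
Qed.

Lemma pr_add x y : pr (LAdd x y) = pr x + pr y.
Proof. by rewrite /pr Defs.pi_add /lie_proj lie_quot_add. Qed.
Lemma pr_scale a x : pr (LScale a x) = a *: pr x.
Proof. by rewrite /pr Defs.pi_scale /lie_proj lie_quot_scale. Qed.
Lemma pr_zero : pr (LZero K (km_gen rz)) = 0.
Proof. by []. Qed.
Lemma lie_proj_br (x y : km_tilde rz) :
  lie_proj r (bracket x y) = bracket (lie_proj r x) (lie_proj r y).
Proof. by rewrite /lie_proj [RHS]qbrE. Qed.
Lemma pr_br x y : pr (LBr x y) = bracket (pr x) (pr y).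
Proof. by rewrite /pr -lie_proj_br [bracket _ _]pbrE. Qed.

Lemma pr_surj (x : g) : exists t, x = pr t.
Proof.
have [y ->] := lie_quot_surj x; have [t ->] := pi_surj y.
by exists t.
Qed.

Lemma km_generated (P : g -> Prop) : subspace P ->
  (forall x y, P x -> P y -> P (bracket x y)) ->
  (forall t, P (km_h r t)) -> (forall i, P (km_e i)) ->
  (forall i, P (km_f i)) -> forall x, P x.
Proof.
move=> sP Pbr Ph Pe Pf x; have [t ->] := pr_surj x.
elim: t => [[s|i|i]||t Pt u Pu|c t Pt|t Pt u Pu].
- exact: Ph.
- exact: Pe.
- exact: Pf.
- by rewrite pr_zero; exact: subspace0.
- by rewrite pr_add; exact: subspaceD.
- by rewrite pr_scale; exact: subspaceZ.
- by rewrite pr_br; exact: Pbr.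
Qed.

Lemma km_h_linear : linear (km_h r).
Proof.
by move=> c x y; have := pr_rel (km_lin c x y); rewrite pr_add pr_scale.
Qed.

Lemma km_br_hh s t : bracket (km_h r s) (km_h r t) = 0.
Proof. by have := pr_rel (km_hh s t); rewrite pr_br. Qed.

Lemma km_br_he t i : bracket (km_h r t) (km_e i) = (Defs.root rz i t : K) *: km_e i.
Proof. by have := pr_rel (km_he t i); rewrite pr_br pr_scale. Qed.

Lemma km_br_hf t i : bracket (km_h r t) (km_f i) = - (Defs.root rz i t : K) *: km_f i.
Proof. by have := pr_rel (km_hf t i); rewrite pr_br pr_scale. Qed.

Lemma km_br_ef i j :
  bracket (km_e i) (km_f j) = if i == j then km_h r (coroot rz i) else 0.
Proof. by have := pr_rel (km_ef rz i j); rewrite pr_br; case: eqP. Qed.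

(** The preimage of J is an ideal that contains r and meets h only in 0. *)
Lemma km_no_ideal (J : g -> Prop) : subspace J ->
  (forall x y, J y -> J (bracket x y)) ->
  (forall t, J (km_h r t) -> km_h r t = 0) -> forall x, J x -> x = 0.
Proof.
move=> sJ Jbr Jh x Jx.
have proj0 : lie_proj r (0 : km_tilde rz) = 0 by [].
have proj_eq0 (y : km_tilde rz) : lie_proj r y = 0 <-> ideal_set r y.
  by rewrite -proj0 /lie_proj lie_quot_eqP subr0.
pose S := [set y : km_tilde rz | J (lie_proj r y)]%classic.
have S0 : S 0 by rewrite /S /= proj0; exact: subspace0.
have SP (c : K) (y z : km_tilde rz) : S y -> S z -> S (c *: y + z).
  rewrite /S /= => Jy Jz; rewrite /lie_proj lie_quot_add lie_quot_scale.
  exact: subspaceP.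
have Sbr y z : S z -> S (bracket y z).
  by rewrite /S /= lie_proj_br; exact: Jbr.
pose s := LieIdeal S0 SP Sbr.
case: r_rad => rH r_max.
have sr : (s `<=` r)%classic.
  apply: r_max.
    apply/seteqP; split=> [y [Sy [t _ ty]]|y ->]; last first.
      split; first exact: S0.
      by have : [set 0]%classic (0 : km_tilde rz) by []; rewrite -rH => -[].
    rewrite -rH; split; last by exists t.
    by apply/proj_eq0; rewrite -ty; apply: Jh; move: Sy; rewrite /= /S -ty.
  move=> y /proj_eq0 y0; rewrite /= /S /= y0.
  exact: subspace0.
have [y xE] := lie_quot_surj x; rewrite xE; apply/proj_eq0/sr.
by rewrite /= /S /= -[lie_proj r y]xE.
Qed.

(** The map sending t to the values of the simple roots at t is onto: a
    functional vanishing on its image is a linear relation between the roots. *)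
Lemma root_dual : exists dual : 'I_n -> cartan rz,
  forall i j, (Defs.root rz i (dual j) : K) = (i == j)%:R.
Proof.
pose ev0 t : 'rV[K]_n := \row_i (Defs.root rz i t : K).
have [|ev evE] := @linear_hom K (cartan rz) 'rV[K]_n ev0.
  by move=> c s t; apply/rowP => i; rewrite !mxE linearP.
suff evf : limg ev = fullv.
  have /choice[dual dualE] (j : 'I_n) : exists t, ev t = delta_mx 0 j.
    have : (delta_mx 0 j : 'rV[K]_n) \in limg ev by rewrite evf memvf.
    by case/memv_imgP => t _ ->; exists t.
  exists dual => i j; have := congr1 (fun u : 'rV[K]_n => u 0 i) (dualE j).
  by rewrite evE !mxE eqxx.
apply/eqP; apply: contraT => /separating_functional[phi phi_neq0 phi0].
case/eqP: phi_neq0; apply/lfunP => u; rewrite zero_lfunE.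
have phiE (w : 'rV[K]_n) : phi w = \sum_i (w 0 i * phi (delta_mx 0 i) : K).
  by rewrite {1}[w]row_sum_delta linear_sum; apply: eq_bigr => i _; rewrite linearZ.
have phi_delta : forall i, (phi (delta_mx 0 i) : K) = 0.
  move/freeP: (free_root rz) => /(_ (fun i => phi (delta_mx 0 i) : K)); apply.
  apply/lfunP => t; rewrite sum_lfunE zero_lfunE.
  rewrite -[RHS](phi0 (ev t)) ?memv_img ?memvf // phiE; apply: eq_bigr => i _.
  rewrite scale_lfunE -tnth_nth tnth_mktuple evE mxE.
  exact: mulrC.
by rewrite phiE big1 // => i _; rewrite phi_delta mulr0.
Qed.


Lemma grade_piece_subspace a i : subspace (grade_piece r a i).
Proof.
split; first by exists [::]; rewrite big_nil.
move=> c _ _ [s1 [s1P ->]] [s2 [s2P ->]].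
exists ([seq c *: y | y <- s1] ++ s2); split; last first.
  by rewrite big_cat big_map scaler_sumr.
move=> y; rewrite mem_cat => /orP[/mapP[z zs ->]|]; last exact: s2P.
have [m [ma mz]] := s1P z zs; exists m; split=> // t.
by rewrite bracketZr mz !scalerA mulrC.
Qed.

Lemma root_combE (m : 'I_n -> int) t :
  (root_comb rz m t : K) = \sum_j (Defs.root rz j t : K) *~ m j.
Proof.
rewrite /root_comb sum_lfunE; apply: eq_bigr => j _.
by rewrite -scaler_int scale_lfunE [LHS]mulrzl.
Qed.

Lemma grade_pieceE dual a k x :
  (forall i j, (Defs.root rz i (dual j) : K) = (i == j)%:R) -> (0 < k)%N ->
  grade_piece r a k x <-> lin_span (degree_word km_e a k) x.
Proof.
move=> dualE k_gt0; split.
  case=> s [sP ->]; have sC := lin_span_subspace (degree_word km_e a k).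
  rewrite big_seq; apply: (subspace_sum _ sC) => y /sP[m [ma my]].
  apply: (degree_word_eigen km_h_linear km_br_hh km_br_he km_br_hf km_br_ef
            km_generated dualE) => //.
  rewrite my root_combE (bigD1 a) //= dualE eqxx ma big1 ?addr0 // => j ja.
  by rewrite dualE (negPf ja) mul0rz.
move=> xC; apply: xC; first exact: grade_piece_subspace.
move=> _ [i [w [-> cw]]]; exists [:: word km_e w i]; split; last by rewrite big_seq1.
move=> y; rewrite inE => /eqP->.
exists (fun j => Posz (count_mem j (i :: w))); split; first by rewrite cw.
move=> t; rewrite (weight_word (be := fun i t => Defs.root rz i t : K)).
  2: exact: km_br_he.
rewrite root_combE; congr (_ *: _).
have countE j : (Defs.root rz j t : K) *~ Posz (count_mem j (i :: w))
    = \sum_(l <- i :: w | l == j) (Defs.root rz l t : K).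
  rewrite -pmulrn -sum1_count -sumrMnr.
  by apply: eq_bigr => l /eqP->.
under [RHS]eq_bigr => j _ do rewrite countE.
rewrite (exchange_big_dep xpredT) //=; apply: eq_bigr => l _.
by rewrite (big_pred1 l).
Qed.

End KacMoodyGrading.

Theorem corollary2 (R : realType) (n : nat) (A : 'M[int]_n)
  (A_gcm : is_gcm A) (rz : realization R[i] A)
  (r : lie_ideal (km_tilde rz)) (r_rad : km_radical r)
  (a : 'I_n) (a_arrows : forall i : 'I_n, arrow_mult A i a <= 1)
  (d1 : nat) (dim_g1 : has_dim (grade_piece r a 1) d1) :
  exists2 d2 : nat, has_dim (grade_piece r a 2) d2 &
    d2%:Z <= 'C(d1, 2)%:Z - (2 * d1%:Z - 3).
Proof.
have [dual dualE] := root_dual rz.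
have pieceE k : (0 < k)%N -> grade_piece r a k = lin_span (degree_word (km_e r) a k).
  by move=> k_gt0; apply/funext => x; apply/propext; exact: (grade_pieceE _ _ dualE).
rewrite (pieceE 1%N) // in dim_g1; rewrite (pieceE 2%N) //.
case: A_gcm => A_diag A_off A_zero.
have [|||d2 dim2 d2_le] := dim_degree2 (@km_h_linear _ _ _ _ r)
  (@km_br_hh _ _ _ _ r) (@km_br_he _ _ _ _ r) (@km_br_hf _ _ _ _ r)
  (@km_br_ef _ _ _ _ r) (@km_generated _ _ _ _ r) dualE _ (km_no_ideal r_rad)
  _ _ dim_g1.
- by move=> i s t; rewrite linearD.
- by rewrite root_coroot A_diag.
- move=> i ia; rewrite !root_coroot.
  have := a_arrows i; rewrite /arrow_mult (negPf ia) => A_ge.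
  have := A_off a i; rewrite eq_sym => /(_ ia) A_le.
  have [Aai|Aai] : A a i = 0 \/ A a i = -1 by lia.
    by right; rewrite Aai (A_zero _ _ Aai).
  by left; rewrite Aai.
exists d2 => //; case: d1 d2_le {dim_g1} => [|[|k]] /=.
- by rewrite bin_small //; lia.
- by rewrite bin_small //; lia.
by rewrite !binS !bin1 bin0; lia.
Qed.
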